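(* Let $\mathcal{G}(\mathcal{V},\mathcal{E},\bm{A},\bm{\tau})$ be a delay-embedded graph. If the frequency-domain signed Laplacian $\bm{L}_\tau(s)$ is positive semi-definite with a simple zero eigenvalue for every $s\in\mathbb{C}$ in the right half plane $\{s:\mathrm{Re}\, s\ge 0\}$, then the system $$\dot{x}_i(t)=\sum_{j=1}^n a_{ij}\bigl(x_j(t-\tau_{ij})-x_i(t-\tau_{ij})\bigr),\qquad i=1,\dots,n,$$ reaches an average consensus.
   Context: Delay-embedded graph: $\mathcal{G}(\mathcal{V},\mathcal{E},\bm{A},\bm{\tau})$ is a connected weighted undirected graph with node set $\mathcal{V}=\{1,\dots,n\}$ and edge set $\mathcal{E}$ (unordered pairs $(i,j)$, $i\ne j$). $\bm{A}=[a_{ij}]\in\mathbb{R}^{n\times n}$ is the weighted adjacency matrix: $a_{ii}=0$; $a_{ij}=a_{ji}$ is the weight (positive or negative) of the edge $(i,j)\in\mathcal{E}$; $a_{ij}=0$ if $(i,j)\notin\mathcal{E}$. $\bm{\tau}=[\tau_{ij}]\in\mathbb{R}^{n\times n}$ is the delay matrix: $\tau_{ii}=0$; $\tau_{ij}=\tau_{ji}\ge 0$ is the delay of the edge $(i,j)\in\mathcal{E}$ (arbitrarily large values allowed); $\tau_{ij}=0$ if $(i,j)\notin\mathcal{E}$. Laplacian of edge values $w_{ij}=w_{ji}$ (with $w_{ij}=0$ if $(i,j)\notin\mathcal{E}$): the real symmetric matrix with diagonal entries $\sum_{j\ne i}w_{ij}$ and off-diagonal entries $-w_{ij}$. $\bm{L}_0$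 is the Laplacian with $w_{ij}=a_{ij}$. Standing assumption: $\bm{L}_0$ is positive semi-definite with a simple zero eigenvalue. Frequency-domain signed Laplacian: for $s=r+\mathrm{j}\omega$ with $r,\omega\in\mathbb{R}$, $\mathrm{j}=\sqrt{-1}$, $\bm{L}_\tau(s)\in\mathbb{R}^{n\times n}$ is the Laplacian with edge values $w_{ij}(s)=a_{ij}e^{-\tau_{ij}r}\cos(\tau_{ij}\omega)$. Solutions: $\bm{x}(t)=[x_i(t)]\in\mathbb{R}^n$ is continuous on $[0,\infty)$ with arbitrary initial value $\bm{x}(0)$, satisfies the equation for almost every $t\ge0$, with $x_i(t)=0$ for $t<0$ (so that its Laplace transform $\bm{X}(s)$ satisfies $sX_i(s)-x_i(0)=\sum_j a_{ij}e^{-\tau_{ij}s}(X_j(s)-X_i(s))$). The system reaches an average consensus if, for every $\bm{x}(0)$, $\lim_{t\to\infty}\bm{x}(t)=c\bm{1}_n$ with $c=\frac1n\bm{1}_n^T\bm{x}(0)$, where $\bm{1}_n$ is the all-ones vector. *)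

(* Defs.v *)
From HB Require Import structures.
From mathcomp Require Import all_boot all_order all_algebra.
From mathcomp Require Import all_classical all_reals all_analysis.
From mathcomp Require Import complex.

Set Implicit Arguments.
Unset Strict Implicit.
Unset Printing Implicit Defensive.

Import Order.TTheory GRing.Theory Num.Theory.
Import numFieldNormedType.Exports.

Local Open Scope classical_set_scope.
Local Open Scope ring_scope.

(* The node set {1, ..., n} is ['I_n]; the set of unordered pairs of nodes is
   the symmetric irreflexive relation [edge]. *)
Record delay_graph (R : realType) (n : nat) := DelayGraph {
  edge : rel 'I_n;
  weight : 'M[R]_n;
  delay : 'M[R]_n;
  edge_sym : symmetric edge;
  edge_irr : irreflexive edge;
  edge_connected : forall i j, connect edge i j;
  weight_sym : forall i j, weight i j = weight j i;
  weight_neq0 : forall i j, edge i j -> weight i j != 0;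
  weight_eq0 : forall i j, ~~ edge i j -> weight i j = 0;
  delay_sym : forall i j, delay i j = delay j i;
  delay_ge0 : forall i j, 0 <= delay i j;
  delay_eq0 : forall i j, ~~ edge i j -> delay i j = 0
}.

Definition laplacian (R : realType) (n : nat) (w : 'M[R]_n) : 'M[R]_n :=
  \matrix_(i, j) if i == j then \sum_(k | k != i) w i k else - w i j.

Definition psd (R : realType) (n : nat) (M : 'M[R]_n) : Prop :=
  M^T = M /\ forall v : 'cV[R]_n, 0 <= (v^T *m M *m v) 0 0.

Definition simple_eigenvalue (R : realType) (n : nat) (M : 'M[R]_n) (a : R) :
    Prop :=
  mup a (char_poly M) = 1%N.

Definition signed_laplacian0 (R : realType) (n : nat) (G : delay_graph R n) :
    'M[R]_n :=
  laplacian (weight G).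

Definition freq_signed_laplacian (R : realType) (n : nat)
    (G : delay_graph R n) (s : R[i]) : 'M[R]_n :=
  laplacian (\matrix_(i, j)
    (weight G i j * expR (- (delay G i j * complex.Re s))
                  * cos (delay G i j * complex.Im s))).

Definition abs_continuous (R : realType) (a b : R) (f : R -> R) : Prop :=
  forall e : R, 0 < e -> exists2 d : R, 0 < d &
    forall (m : nat) (u v : 'I_m -> R),
      (forall k, [/\ a <= u k, u k <= v k & v k <= b]) ->
      (forall k l, k != l -> v k <= u l \/ v l <= u k) ->
      \sum_k (v k - u k) < d ->
      \sum_k `|f (v k) - f (u k)| < e.

(* Solutions in the sense of Caratheodory.  Local absolute continuity is what
   makes "the equation holds for almost every t" meaningful: without it one
   could add a Cantor-type singular function to a solution. *)
Record is_solution (R : realType) (n : nat) (G : delay_graph R n)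
    (x : R -> 'cV[R]_n) : Prop := IsSolution {
  solution_past : forall t, t < 0 -> x t = 0;
  solution_continuous : {within `[0, +oo[, continuous x};
  solution_ac : forall i T, 0 < T -> abs_continuous 0 T (fun t => x t i 0);
  solution_eq : {ae (@lebesgue_measure R), forall t : R, 0 <= t ->
    forall i, is_derive t 1 (fun u : R => x u i 0)
      (\sum_j weight G i j *
         (x (t - delay G i j) j 0 - x (t - delay G i j) i 0))}
}.

Definition average (R : realType) (n : nat) (v : 'cV[R]_n) : R :=
  n%:R^-1 * \sum_i v i 0.

Definition reaches_average_consensus (R : realType) (n : nat)
    (G : delay_graph R n) : Prop :=
  forall (x0 : 'cV[R]_n) (x : R -> 'cV[R]_n),
    is_solution G x -> x 0 = x0 ->
    x t @[t --> +oo] --> (const_mx (average x0) : 'cV[R]_n).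

(* Main.v *)
Require Import Defs.
From HB Require Import structures.
From mathcomp Require Import all_boot all_order all_algebra.
From mathcomp Require Import all_classical all_reals all_analysis.
From mathcomp Require Import measurable_realfun complex.
From mathcomp Require Import ring lra.

Set Implicit Arguments.
Unset Strict Implicit.
Unset Printing Implicit Defensive.

Import Order.TTheory GRing.Theory Num.Theory.
Import numFieldNormedType.Exports.

Local Open Scope ring_scope.

(** Why the theorem holds.

    Write [V v] for the sum of all [(v i - v j) ^+ 2].  On the imaginary axis
    [s = i w] the hypothesis says that the form with weights
    [a i j * cos (tau i j * w)] is nonnegative and vanishes only at consensus, so
    by compactness it dominates [e * V] on every bounded band of frequencies
    ([uniform_form_bound]).  Positivity may degenerate as [w] grows.  At high
    frequency, however, a signal that almost solves the equation is small, since
    the derivative multiplies by [i w] while the coupling stays bounded.  Hence,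
    for every [K > 0], the form plus [K] times the squared modulus of the
    transformed residual [y' + L y] dominates [e * V] at all frequencies
    ([freq_bound]).

    By Parseval's identity this becomes an inequality between integrals over time
    for signals of compact support: the power [y . L y] taken out by the delayed
    coupling, plus [K] times the squared residual, dominates [e * V y].  To stay
    with finite sums, time is sampled with a step [h] and the delays are rounded to
    multiples of [h]; the discrete Fourier transform then replaces the integral
    transform, and the rounding is harmless on a bounded band
    ([discrete_dissipation]).

    The inequality is applied to a solution multiplied by a cut-off that rises on
    [[0, d]] and falls on [[T, T + d]].  Away from the two ramps and their delayed
    images the residual vanishes and the power is minus the derivative of half the
    squared norm, so that only boundary terms remain: with [K = d ^+ 2], [e] times
    the integral of [V] is at most [(|x 0|^2 - |x T|^2) / 2] plus [C * M ^+ 2 * d],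
    where [M] bounds the solution and [C] does not depend on [T]
    ([energy_estimate]).

    Letting [d] tend to 0 shows that, from time 1 on, the norm does not exceed its
    initial value ([norm_le_initial]).  Knowing this, [d = 1] bounds the integral
    of [V] uniformly in [T].  As the solution is Lipschitz, [V] tends to 0
    ([disagreement_to0]); as the coupling is symmetric, the sum of the coordinates
    is constant ([solution_sum]), so the limit is the average.

    The differential equation, which holds only almost everywhere, is used through
    a mean value inequality for absolutely continuous functions
    ([ae_derive_growth]). *)

(** * Laplacian forms and their kernels *)

Section Laplacian.
Variables (R : realType) (n : nat).
Implicit Types (w : 'M[R]_n) (v : 'cV[R]_n).

Lemma laplacian_mulE w v i :
  (laplacian w *m v) i 0 = \sum_j w i j * (v i 0 - v j 0).
Proof.
rewrite mxE (bigD1 i)//= [RHS](bigD1 i)//= subrr mulr0 add0r.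
rewrite mxE eqxx mulr_suml -big_split/=; apply: eq_bigr => j ji.
by rewrite mxE eq_sym (negPf ji) mulrBr mulNr.
Qed.

(** Exchanging the two ends of every edge: each edge is counted from both of
    them, which accounts for the factor 2. *)
Lemma sum_antisym (w : 'I_n -> 'I_n -> R) (p : 'I_n -> R)
    (u : 'I_n -> 'I_n -> R) :
    (forall i j, w i j = w j i) -> (forall i j, u j i = - u i j) ->
  (\sum_i p i * \sum_j w i j * u i j) *+ 2 =
  \sum_i \sum_j w i j * ((p i - p j) * u i j).
Proof.
move=> wC uN; rewrite mulr2n.
under eq_bigr do rewrite mulr_sumr.
rewrite {2}exchange_big -big_split/=; apply: eq_bigr => i _.
rewrite -big_split/=; apply: eq_bigr => j _.
by rewrite (wC j i) uN; ring.
Qed.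

Lemma laplacian_quadE w v : (forall i j, w i j = w j i) ->
  (v^T *m laplacian w *m v) 0 0 *+ 2 =
  \sum_i \sum_j w i j * (v i 0 - v j 0) ^+ 2.
Proof.
move=> wC; rewrite -mulmxA mxE.
under eq_bigr do rewrite mxE laplacian_mulE.
rewrite (@sum_antisym w (fun i => v i 0) (fun i j => v i 0 - v j 0))//.
by move=> i j; rewrite opprB.
Qed.

(** A nonzero cross term between [v] and some [u] would make the form negative
    at [v + c *: u] for a suitable [c]. *)
Lemma psd_ker (M : 'M[R]_n) v :
  psd M -> (v^T *m M *m v) 0 0 = 0 -> M *m v = 0.
Proof.
move=> [MT Mge0] vMv0.
pose b (x y : 'cV[R]_n) := (x^T *m M *m y) 0 0.
have bC x y : b x y = b y x.
  rewrite [RHS]/b.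
  have <- : (x^T *m M *m y)^T = y^T *m M *m x by rewrite !trmx_mul trmxK MT mulmxA.
  by rewrite mxE.
have bDr x y z : b x (y + z) = b x y + b x z by rewrite /b mulmxDr mxE.
have bZr x c y : b x (c *: y) = c * b x y by rewrite /b -scalemxAr mxE.
have b0 (u : 'cV[R]_n) : b u v = 0.
  have scE (c : R) : 0 <= c * (2 * b u v) + c ^+ 2 * b u u.
    have := Mge0 (v + c *: u); rewrite -/(b _ _) bDr bZr !(bC (v + _)) !bDr !bZr.
    by rewrite {1}/b vMv0 (bC v u) expr2 => ?; lra.
  apply/eqP/negP => /negP buv; have [buu|buu] := eqVneq (b u u) 0.
    have := scE (- b u v); rewrite buu.
    have : 0 < b u v ^+ 2 by rewrite exprn_even_gt0.
    by rewrite expr2; lra.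
  (* This [c] minimises the quadratic polynomial of [scE]. *)
  have := scE (- b u v / b u u).
  have -> : - b u v / b u u * (2 * b u v) + (- b u v / b u u) ^+ 2 * b u u =
     - (b u v ^+ 2 / b u u) by field.
  rewrite oppr_ge0 => le0.
  have buu_gt0 : 0 < b u u by rewrite lt_def buu Mge0.
  have : 0 < b u v ^+ 2 / b u u by rewrite divr_gt0// exprn_even_gt0.
  by rewrite ltNge le0.
apply/colP => i; rewrite [RHS]mxE -(b0 (delta_mx i 0)) /b -mulmxA.
rewrite [RHS]mxE (bigD1 i)//= big1 ?addr0.
  by rewrite !mxE !eqxx mul1r.
by move=> j ji; rewrite mxE mxE (negPf ji) mul0r.
Qed.

(** Two independent vectors [1] and [v] of the left kernel of [M], put as
    rows [i] and [j] of an otherwise trivial invertible [P], make these two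
    rows of [P *m ('X - M)] divisible by ['X]; hence ['X^2] divides
    [\det P *: char_poly M]. *)
Lemma simple_eigenvalue_ker (M : 'M[R]_n) v :
  M^T = M -> simple_eigenvalue M 0 -> M *m (const_mx 1 : 'cV[R]_n) = 0 -> M *m v = 0 ->
  forall i j, v i 0 = v j 0.
Proof.
move=> MT M0 M1 Mv i j; apply/eqP/negP => /negP vij.
have ij : j != i by apply: contraNneq vij => ->.
pose P : 'M[R]_n := \matrix_(k, l)
  if k == i then 1 else if k == j then v l 0 else (k == l)%:R.
have Pdet : \det P != 0.
  apply/det0P => -[u u0 uP0]; case/negP: u0; apply/eqP.
  have colE l : u 0 i + (u 0 j * v l 0 +
      (if (l != i) && (l != j) then u 0 l else 0)) = 0.
    have := congr1 (fun A : 'rV_n => A 0 l) uP0; rewrite !mxE.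
    rewrite (bigD1 i)//= (bigD1 j)//= !mxE !eqxx (negPf ij) mulr1 => uPl.
    rewrite -[RHS]uPl.
    congr (_ + (_ + _)); case: ifPn => [/andP[li lj]|lij].
      rewrite (bigD1 l)/= ?li//= mxE eqxx (negPf li) (negPf lj) mulr1 big1 ?addr0//.
      move=> k /andP[/andP[ki kj] kl].
      by rewrite mxE (negPf ki) (negPf kj) (negPf kl) mulr0.
    rewrite big1// => k /andP[ki kj]; rewrite mxE (negPf ki) (negPf kj).
    case: (eqVneq k l) => [kl|]; last by rewrite mulr0.
    by rewrite -kl ki kj in lij.
  have uj : u 0 j = 0.
    have := colE i; have := colE j; rewrite !eqxx andbF/= !addr0 => uj ui.
    have /eqP : u 0 j * (v i 0 - v j 0) = 0 by rewrite mulrBr; lra.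
    by rewrite mulf_eq0 subr_eq0 (negPf vij) orbF => /eqP.
  have ui : u 0 i = 0.
    by have := colE i; rewrite eqxx/= uj mul0r !addr0.
  apply/rowP => l; rewrite mxE; have := colE l; rewrite ui uj mul0r !add0r.
  case: (eqVneq l i) => [->//|li]; case: (eqVneq l j) => [->//|lj] //=.
have PM k l : (k == i) || (k == j) -> (P *m M) k l = 0.
  move=> kij; rewrite -[P *m M]trmxK trmx_mul MT mxE mxE.
  have kerM (x : 'cV[R]_n) : M *m x = 0 -> (forall l', P k l' = x l' 0) ->
      \sum_j0 M l j0 * P^T j0 k = 0.
    move=> Mx Px; have := congr1 (fun A : 'cV_n => A l 0) Mx; rewrite !mxE => Mxl.
    rewrite -[RHS]Mxl.
    by apply: eq_bigr => l' _; rewrite [P^T _ _]mxE Px.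
  case: (eqVneq k i) kij => [ki _|ki /=/eqP kj].
    by apply: kerM M1 _ => l'; rewrite !mxE ki eqxx.
  by apply: kerM Mv _ => l'; rewrite !mxE kj eqxx (negPf ij).
pose D : 'rV[{poly R}]_n := \row_k if (k == i) || (k == j) then 'X else 1.
pose Q : 'M[{poly R}]_n := \matrix_(k, l)
  if (k == i) || (k == j) then (P k l)%:P else 'X * (P k l)%:P - ((P *m M) k l)%:P.
have PXE : map_mx polyC P *m char_poly_mx M = diag_mx D *m Q.
  rewrite /char_poly_mx mulmxBr -map_mxM mul_mx_scalar.
  apply/matrixP => k l; rewrite mul_diag_mx !mxE.
  case: (boolP ((k == i) || (k == j))) => kij; last by rewrite mul1r.
  have := PM k l kij; rewrite mxE => ->; by rewrite subr0.
have := congr1 determinant PXE; rewrite !det_mulmx -/(char_poly M) det_diag.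
rewrite (bigD1 i)//= (bigD1 j)//= !mxE !eqxx orbT/= => detE.
have : ('X - 0%:P) ^+ 2 %| (\det P) %:P * char_poly M.
  rewrite -det_map_mx detE subr0 expr2 -!mulrA !mulrA.
  by rewrite -mulrA dvdp_mulr.
rewrite mul_polyC dvdpZr// -mup_geq ?monic_neq0 ?char_poly_monic//.
by rewrite M0.
Qed.

(** The constant vectors already fill the kernel, which is a line because the
    eigenvalue is simple. *)
Lemma simple_zero_consensus w v : (forall i j, w i j = w j i) ->
  psd (laplacian w) -> simple_eigenvalue (laplacian w) 0 ->
  \sum_i \sum_j w i j * (v i 0 - v j 0) ^+ 2 = 0 ->
  forall i j, v i 0 = v j 0.
Proof.
move=> wC Lpsd L0 /eqP; rewrite -laplacian_quadE// mulrn_eq0/= => /eqP vLv.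
apply: simple_eigenvalue_ker Lpsd.1 L0 _ (psd_ker Lpsd vLv).
apply/colP => i; rewrite laplacian_mulE [RHS]mxE big1// => j _.
by rewrite !mxE subrr mulr0.
Qed.

Lemma psd_laplacian_ge0 w v : (forall i j, w i j = w j i) ->
  psd (laplacian w) -> 0 <= \sum_i \sum_j w i j * (v i 0 - v j 0) ^+ 2.
Proof. by move=> wC [_ L0]; rewrite -laplacian_quadE// mulrn_wge0. Qed.

End Laplacian.

(** * A uniform bound on a band of frequencies *)

Section Disagreement.
Variables (R : realType) (n : nat).

(** The squared distance to consensus, up to the factor [2 * n]. *)
Definition disagreement (v : 'I_n -> R) : R := \sum_i \sum_j (v i - v j) ^+ 2.

Lemma disagreement_ge0 v : 0 <= disagreement v.
Proof. by apply: sumr_ge0 => i _; apply: sumr_ge0 => j _; exact: sqr_ge0. Qed.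

(** From [(v i - v j) ^+ 2 <= 2 * v i ^+ 2 + 2 * v j ^+ 2]. *)
Lemma disagreement_le v : disagreement v <= 4 * n%:R * \sum_i v i ^+ 2.
Proof.
have : disagreement v <= \sum_i \sum_j (2 * v i ^+ 2 + 2 * v j ^+ 2).
  apply: ler_sum => i _; apply: ler_sum => j _.
  by have := sqr_ge0 (v i + v j); rewrite !expr2; lra.
move=> /le_trans; apply.
set S := \sum_i v i ^+ 2.
have E i : \sum_j (2 * v i ^+ 2 + 2 * v j ^+ 2) = 2 * n%:R * v i ^+ 2 + 2 * S.
  by rewrite big_split/= sumr_const card_ord -mulr_sumr -/S -[X in X + _]mulr_natr; ring.
under eq_bigr do rewrite E.
rewrite big_split/= sumr_const card_ord -mulr_sumr -/S -[X in _ + X]mulr_natr.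
by rewrite le_eqVlt; apply/orP; left; apply/eqP; ring.
Qed.

End Disagreement.

Section UniformBound.
Variables (R : realType) (n : nat) (a tau : 'I_n -> 'I_n -> R).

Let form (w : R) (v : 'I_n -> R) :=
  \sum_i \sum_j a i j * cos (tau i j * w) * (v i - v j) ^+ 2.

(** The penalty makes the form positive on nonzero constant vectors too, so
    that it can be minimised on a sphere. *)
Let form_pen (p : R * 'rV[R]_n) := form p.1 (p.2 0) + (\sum_i p.2 0 i) ^+ 2.

Lemma continuous_sumr (T : topologicalType) (I : finType) (F : I -> T -> R) :
  (forall i, continuous (F i)) -> continuous (fun x => \sum_i F i x).
Proof.
move=> cF; apply: continuous_big => [|i _]; [exact: add_continuous|exact: cF].
Qed.

Lemma form_pen_continuous : continuous form_pen.
Proof.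
have cv i : continuous (fun p : R * 'rV[R]_n => p.2 0 i).
  move=> p; apply: (@continuous_comp _ _ _ snd (fun v : 'rV[R]_n => v 0 i)).
    exact: cvg_snd.
  exact: coord_continuous.
move=> p; apply: cvgD.
  apply: (@continuous_sumr (R * 'rV[R]_n)%type _
    (fun i p => \sum_j a i j * cos (tau i j * p.1) * (p.2 0 i - p.2 0 j) ^+ 2)).
  move=> i; apply: continuous_sumr => j q; apply: cvgM.
    apply: cvgMr; apply: (@continuous_comp _ _ _ (fun p => tau i j * p.1) cos).
      by apply: cvgMr; exact: cvg_fst.
    exact: continuous_cos.
  by rewrite expr2; apply: cvgM; apply: cvgB; exact: cv.
have cs : continuous (fun p : R * 'rV[R]_n => \sum_i p.2 0 i).
  by apply: continuous_sumr => i; exact: cv.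
by rewrite expr2; apply: cvgM; exact: cs.
Qed.

Hypothesis form_ge0 : forall w v, 0 <= form w v.
Hypothesis form_eq0 : forall w v, form w v = 0 -> forall i j, v i = v j.

Lemma sphere_compact : compact [set v : 'rV[R]_n | \sum_i v 0 i ^+ 2 = 1]%classic.
Proof.
have cube : compact [set v : 'rV[R]_n | forall i, v ord0 i \in `[(- 1), 1]%R]%classic.
  apply: (@rV_compact R n (fun=> `[(- 1), 1]%classic)) => _.
  exact: segment_compact.
apply: subclosed_compact cube _; last first.
  move=> v /= v1 i; rewrite in_itv/= -ler_norml -(@expr_le1 _ 2)// real_normK ?num_real//.
  by rewrite -v1 (bigD1 i)//= lerDl; apply: sumr_ge0 => k _; exact: sqr_ge0.
apply: (@preimage_closed _ _ (fun v : 'rV[R]_n => \sum_i v 0 i ^+ 2) [set 1]%classic).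
  move=> v _; apply: continuous_sumr => i u.
  by apply: (@continuous_comp _ _ _ (fun v : 'rV[R]_n => v 0 i) (fun x : R => x ^+ 2));
    [exact: coord_continuous|exact: exprn_continuous].
exact: closed_eq.
Qed.

(** Compactness of the frequency band times the unit sphere turns the strict
    positivity off consensus into a uniform bound.  Adding the square of the
    sum makes the form positive on the whole sphere, and subtracting the mean
    removes this extra term without changing either side. *)
Lemma uniform_form_bound W : 0 <= W -> exists2 e : R, 0 < e &
  forall w v, `|w| <= W -> e * disagreement v <= form w v.
Proof.
move=> W0; have [n0|n_gt0] := posnP n.
  exists 1 => // w v _; rewrite /disagreement /form.
  by rewrite !big1 ?mulr0// => i; exfalso; case: i; rewrite n0.
pose i0 := Ordinal n_gt0.
pose K := (`[- W, W] `*` [set v : 'rV[R]_n | \sum_i v 0 i ^+ 2 = 1])%classic.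
have K0 : (K !=set0)%classic.
  exists (0, delta_mx 0 i0); split => /=.
    by rewrite in_itv/= oppr_le0 W0.
  rewrite (bigD1 i0)//= mxE !eqxx expr1n big1 ?addr0// => j /negPf ji.
  by rewrite mxE ji andbF expr0n.
have cK : compact K.
  by apply: compact_setX; [exact: segment_compact|exact: sphere_compact].
have [|[w0 v0]] := @compact_EVT_min _ R form_pen K K0 cK.
  by apply: continuous_subspaceT; exact: form_pen_continuous.
rewrite inE => -[/= _ v0_1] Kmin.
have e_gt0 : 0 < form_pen (w0, v0).
  rewrite lt_def addr_ge0 ?sqr_ge0 ?form_ge0// andbT.
  rewrite paddr_eq0 ?sqr_ge0 ?form_ge0// sqrf_eq0; apply/negP => /= /andP[/eqP q0 /eqP s0].
  have vE i : v0 0 i = v0 0 i0 by apply: (form_eq0 q0).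
  move: s0; under eq_bigr do rewrite vE.
  rewrite sumr_const card_ord => /eqP; rewrite mulrn_eq0 eqn0Ngt n_gt0/= => /eqP v00.
  have : \sum_i v0 0 i ^+ 2 = 0 by rewrite big1// => i _; rewrite vE v00 expr0n.
  by move/eqP; rewrite v0_1 oner_eq0.
set e := form_pen _ in e_gt0 Kmin.
have n_ge0 : (0 : R) < n%:R by rewrite ltr0n.
exists (e / (4 * n%:R)) => [|w v wW]; first by rewrite divr_gt0// mulr_gt0.
pose m := n%:R^-1 * \sum_i v i; pose u i := v i - m.
have uv i j : u i - u j = v i - v j by rewrite /u; lra.
have -> : form w v = form w u.
  by apply: eq_bigr => i _; apply: eq_bigr => j _; rewrite uv.
have -> : disagreement v = disagreement u.
  by apply: eq_bigr => i _; apply: eq_bigr => j _; rewrite uv.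
have u0 : \sum_i u i = 0.
  rewrite sumrB sumr_const card_ord -[X in _ - X]mulr_natl /m mulrA divff ?gt_eqF//.
  by rewrite mul1r subrr.
rewrite -mulrA (le_trans (y := e * \sum_i u i ^+ 2))//.
  rewrite ler_pM2l// mulrC ler_pdivrMr ?mulr_gt0// mulrC.
  exact: disagreement_le.
set s := \sum_i u i ^+ 2; have s_ge0 : 0 <= s by apply: sumr_ge0 => i _; exact: sqr_ge0.
have [s0|s_neq0] := eqVneq s 0; first by rewrite s0 mulr0 form_ge0.
have s_gt0 : 0 < s by rewrite lt_def s_neq0.
pose r := Num.sqrt s; have rr : r ^+ 2 = s by rewrite sqr_sqrtr.
have r0 : r != 0 by rewrite sqrtr_eq0 -ltNge.
have := Kmin (w, \row_i (u i / r)); rewrite inE => /(_ _)/wrap[].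
  split=> /=; first by rewrite in_itv/= -ler_norml.
  under eq_bigr do rewrite mxE exprMn.
  by rewrite -mulr_suml exprVn rr divff.
rewrite /form_pen /=; under [X in _ <= _ + X ^+ 2]eq_bigr do rewrite mxE.
rewrite -mulr_suml u0 mul0r expr0n addr0 -(ler_pM2r s_gt0) => /le_trans; apply.
rewrite /form mulr_suml le_eqVlt; apply/orP; left; apply/eqP.
apply: eq_bigr => i _; rewrite mulr_suml; apply: eq_bigr => j _.
rewrite !mxE -[LHS]mulrA; congr (_ * _).
have -> : (u i / r - u j / r) ^+ 2 * s = (u i - u j) ^+ 2 / r ^+ 2 * s by field.
by rewrite rr divfK.
Qed.

End UniformBound.

(** * The discrete Fourier transform of real signals *)

Section DFT.
Variable R : realType.
Implicit Types (f g : nat -> R) (N k m t : nat) (th : R).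

Definition csum N f th : R := \sum_(t < N) f t * cos (t%:R * th).
Definition ssum N f th : R := \sum_(t < N) f t * sin (t%:R * th).

Definition freq N k : R := 2 * pi * k%:R / N%:R.

(** The delay by [m] steps of a signal that starts at time 0. *)
Definition rshift m f t : R := if (m <= t)%N then f (t - m)%N else 0.

Lemma sin_mulnpi k : sin (k%:R * (2 * pi)) = 0 :> R.
Proof.
elim: k => [|k IH]; first by rewrite mul0r sin0.
by rewrite -natr1 mulrDl mul1r [X in _ + X]mulr_natl sinD2pi.
Qed.

Lemma cos_mulnpi k : cos (k%:R * (2 * pi)) = 1 :> R.
Proof.
elim: k => [|k IH]; first by rewrite mul0r cos0.
by rewrite -natr1 mulrDl mul1r [X in _ + X]mulr_natl cosD2pi.
Qed.

(** Multiplying by [2 * sin (al / 2)] makes the cosine sum telescope. *)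
Lemma sum_cos N (al : R) :
  2 * sin (al / 2) * \sum_(k < N) cos (k%:R * al) =
  sin (N%:R * al - al / 2) + sin (al / 2).
Proof.
elim: N => [|N IH].
  by rewrite big_ord0 mulr0 mul0r add0r sinN addNr.
rewrite big_ord_recr/= mulrDr IH.
have -> : N.+1%:R * al - al / 2 = N%:R * al + al / 2 by rewrite -natr1; field.
by rewrite (sinD _ (al / 2)) sinB; ring.
Qed.

Lemma sum_cos_freq N d : (0 < d < N)%N ->
  \sum_(k < N) cos (d%:R * freq N k) = 0.
Proof.
move=> /andP[d0 dN]; have N0 : (0 < N)%N by exact: leq_ltn_trans dN.
have NR : N%:R != 0 :> R by rewrite pnatr_eq0 -lt0n.
have NR0 : (0 : R) < N%:R by rewrite ltr0n.
pose al : R := 2 * pi * d%:R / N%:R.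
rewrite (eq_bigr (fun k : 'I_N => cos (k%:R * al))); last first.
  by move=> k _; congr cos; rewrite /freq /al; field.
have := sum_cos N al.
have -> : N%:R * al - al / 2 = d%:R * (2 * pi) - al / 2 by rewrite /al; field.
rewrite sinB sin_mulnpi cos_mulnpi mul0r mul1r add0r addNr => /eqP.
have sal : 0 < sin (al / 2).
  apply: sin_gt0_pi; have p0 := @pi_gt0 R.
  have -> : al / 2 = pi * (d%:R / N%:R) by rewrite /al; field.
  rewrite mulr_gt0 ?divr_gt0 ?ltr0n//= gtr_pMr// ltr_pdivrMr// mul1r.
  by rewrite ltr_nat.
by rewrite mulf_eq0 mulf_eq0 (gt_eqF sal) pnatr_eq0/= => /eqP.
Qed.

Lemma sum_cos_freqB N (t u : 'I_N) :
  \sum_(k < N) cos (t%:R * freq N k - u%:R * freq N k) = N%:R * (t == u)%:R :> R.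
Proof.
wlog tu : t u / (u <= t)%N => [th|].
  have [/th//|/ltnW/th] := leqP u t.
  rewrite eq_sym => <-; apply: eq_bigr => k _.
  by rewrite -cosN opprB.
rewrite (eq_bigr (fun k : 'I_N => cos ((t - u)%N%:R * freq N k))); last first.
  by move=> k _; rewrite natrB// mulrBl.
have [->|ntu] := eqVneq t u.
  under eq_bigr do rewrite subnn mul0r cos0.
  by rewrite sumr_const card_ord mulr1.
rewrite mulr0 sum_cos_freq// subn_gt0 ltn_neqAle tu andbT eq_sym.
by rewrite ntu/= (leq_ltn_trans (leq_subr _ _)).
Qed.

(** Parseval's identity for the discrete Fourier transform. *)
Lemma parseval N f g :
  \sum_(k < N) (csum N f (freq N k) * csum N g (freq N k) +
                ssum N f (freq N k) * ssum N g (freq N k)) =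
  N%:R * \sum_(t < N) f t * g t.
Proof.
transitivity (\sum_(k < N) \sum_(t < N) \sum_(u < N)
    f t * g u * cos (t%:R * freq N k - u%:R * freq N k)).
  apply: eq_bigr => k _; rewrite /csum /ssum !mulr_suml -big_split/=.
  apply: eq_bigr => t _; rewrite !mulr_sumr -big_split/=.
  by apply: eq_bigr => u _; rewrite cosB; ring.
rewrite exchange_big mulr_sumr/=; apply: eq_bigr => t _.
rewrite exchange_big/= (bigD1 t)//= -mulr_sumr sum_cos_freqB eqxx mulr1.
rewrite [X in _ + X]big1 ?addr0; first by rewrite mulrC.
move=> u ut; rewrite -mulr_sumr sum_cos_freqB eq_sym (negPf ut) mulr0 mulr0.
by [].
Qed.

(** The support of [f] ends early enough for the delayed signal not to leave the
    window, so that the delay is not cyclic and yet turns into a rotation of the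
    Fourier coefficients. *)
Lemma sum_rshift N m f (c : nat -> R) :
  (forall t, (N <= t + m)%N -> f t = 0) ->
  \sum_(t < N) rshift m f t * c t = \sum_(t < N) f t * c (t + m)%N.
Proof.
move=> f0.
have [Nm|mN] := leqP N m.
  rewrite !big1// => t _; first by rewrite f0 ?mul0r// (leq_trans Nm)// leq_addl.
  by rewrite /rshift leqNgt (leq_trans (ltn_ord t))// mul0r.
rewrite -!(big_mkord xpredT (fun t => rshift m f t * c t)).
rewrite -!(big_mkord xpredT (fun t => f t * c (t + m)%N)).
rewrite (big_cat_nat (n := m))//= 1?ltnW// big_nat_cond big1 ?add0r; last first.
  by move=> t /andP[/andP[_ tm] _]; rewrite /rshift leqNgt tm mul0r.
rewrite -{1}[m]add0n big_addn [RHS](big_cat_nat (n := N - m))//= ?leq_subr//.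
rewrite [X in _ = _ + X]big_nat_cond [X in _ = _ + X]big1 ?addr0; last first.
  by move=> t /andP[/andP[tm _] _]; rewrite f0 ?mul0r// addnC -leq_subLR.
by apply: eq_bigr => t _; rewrite /rshift leq_addl addnK.
Qed.

Lemma csum_rshift N m f th : (forall t, (N <= t + m)%N -> f t = 0) ->
  csum N (rshift m f) th =
  cos (m%:R * th) * csum N f th - sin (m%:R * th) * ssum N f th.
Proof.
move=> f0; rewrite /csum /ssum.
rewrite [LHS](@sum_rshift N m f (fun t => cos (t%:R * th)))// !mulr_sumr -sumrB.
by apply: eq_bigr => t _; rewrite natrD mulrDl cosD; ring.
Qed.

Lemma ssum_rshift N m f th : (forall t, (N <= t + m)%N -> f t = 0) ->
  ssum N (rshift m f) th =
  sin (m%:R * th) * csum N f th + cos (m%:R * th) * ssum N f th.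
Proof.
move=> f0; rewrite /csum /ssum.
rewrite [LHS](@sum_rshift N m f (fun t => sin (t%:R * th)))// !mulr_sumr -big_split/=.
by apply: eq_bigr => t _; rewrite natrD mulrDl sinD; ring.
Qed.

Lemma csumB N f g th :
  csum N (fun t => f t - g t) th = csum N f th - csum N g th.
Proof. by rewrite /csum -sumrB; apply: eq_bigr => t _; rewrite mulrBl. Qed.

Lemma ssumB N f g th :
  ssum N (fun t => f t - g t) th = ssum N f th - ssum N g th.
Proof. by rewrite /ssum -sumrB; apply: eq_bigr => t _; rewrite mulrBl. Qed.

Lemma csum_lin N c f (I : finType) (b : I -> R) (F : I -> nat -> R) th :
  csum N (fun t => c * f t + \sum_j b j * F j t) th =
  c * csum N f th + \sum_j b j * csum N (F j) th.
Proof.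
rewrite /csum; under [X in _ = _ + X]eq_bigr do rewrite mulr_sumr.
rewrite exchange_big mulr_sumr -big_split/=; apply: eq_bigr => t _.
by rewrite mulrDl mulr_suml mulrA; congr (_ + _); apply: eq_bigr => j _; rewrite mulrA.
Qed.

Lemma ssum_lin N c f (I : finType) (b : I -> R) (F : I -> nat -> R) th :
  ssum N (fun t => c * f t + \sum_j b j * F j t) th =
  c * ssum N f th + \sum_j b j * ssum N (F j) th.
Proof.
rewrite /ssum; under [X in _ = _ + X]eq_bigr do rewrite mulr_sumr.
rewrite exchange_big mulr_sumr -big_split/=; apply: eq_bigr => t _.
by rewrite mulrDl mulr_suml mulrA; congr (_ + _); apply: eq_bigr => j _; rewrite mulrA.
Qed.

End DFT.

(** * The dissipation inequality at one frequency *)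

Section Trigo.
Variable R : realType.
Implicit Types x y u : R.

Lemma sin_cos_mvt x y : x <= y ->
  exists2 c, x <= c <= y & sin y - sin x = cos c * (y - x).
Proof.
move=> xy; have [|c] := @MVT_segment R sin cos x y xy (fun z _ => is_derive_sin z).
  by apply: continuous_subspaceT; exact: continuous_sin.
by rewrite in_itv/= => ? ?; exists c.
Qed.

Lemma cos_lipschitz x y : `|cos x - cos y| <= `|x - y|.
Proof.
wlog xy : x y / x <= y => [th|].
  by have [/th//|/ltW/th] := leP x y; rewrite distrC [`|y - _|]distrC.
have [|c _ cE] := @MVT_segment R cos (fun z => - sin z) x y xy (fun z _ => is_derive_cos z).
  by apply: continuous_subspaceT; exact: continuous_cos.
rewrite distrC cE normrM normrN [`|x - y|]distrC ler_piMl//; exact: sin_max.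
Qed.

(** Half-angle formula, with [v / 2 <= sin v] on a small interval. *)
Lemma one_sub_cos_ge u : 0 <= u <= 1 -> u ^+ 2 / 8 <= 1 - cos u.
Proof.
move=> /andP[u0 u1]; pose v := u / 2.
have v0 : 0 <= v by rewrite divr_ge0.
have [c /andP[c0 cv]] := sin_cos_mvt v0; rewrite sin0 !subr0 => sE.
have : 2^-1 <= cos c.
  have := cos_lipschitz c 0; rewrite cos0 subr0 (ger0_norm c0) ler_norml.
  by move: cv; rewrite /v => ? /andP[? _]; lra.
move=> c2; have sv : v / 2 <= sin v by rewrite sE mulrC ler_wpM2r.
have -> : cos u = 1 - 2 * sin v ^+ 2.
  have -> : u = v + v by rewrite /v; field.
  by rewrite cosD -!expr2 cos2sin2; ring.
have : (v / 2) ^+ 2 <= sin v ^+ 2 by rewrite ler_sqr ?nnegrE ?divr_ge0// (le_trans _ sv)// divr_ge0.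
have -> : (v / 2) ^+ 2 = u ^+ 2 / 16 by rewrite /v; field.
lra.
Qed.

Lemma cos_le_cos x y : 0 <= x -> x <= y -> y <= pi -> cos y <= cos x.
Proof.
move=> x0 xy ypi; rewrite leNgt; apply/negP.
rewrite ltr_cos ?in_itv/= ?x0 ?(le_trans xy)// ?(le_trans x0)//.
by rewrite ltNge xy.
Qed.

End Trigo.

Section FreqBound.
Variables (R : realType) (n : nat).

(** The defect in this Cauchy-Schwarz inequality is half the disagreement. *)
Lemma sqr_sum_le (b : 'I_n -> R) : (\sum_j b j) ^+ 2 <= n%:R * \sum_j b j ^+ 2.
Proof.
have : 0 <= disagreement b by exact: disagreement_ge0.
have -> : disagreement b = 2 * (n%:R * \sum_j b j ^+ 2 - (\sum_j b j) ^+ 2).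
  pose S := \sum_j b j; pose Q := \sum_j b j ^+ 2.
  have E i : \sum_j (b i - b j) ^+ 2 = n%:R * b i ^+ 2 + Q - 2 * S * b i.
    rewrite (eq_bigr (fun j => b i ^+ 2 + b j ^+ 2 - 2 * b i * b j)); last first.
      by move=> j _; ring.
    rewrite sumrB big_split/= sumr_const card_ord -mulr_sumr -/S -/Q.
    by rewrite -[X in X + Q - _]mulr_natl; ring.
  rewrite /disagreement (eq_bigr _ (fun i _ => E i)) sumrB big_split/=.
  rewrite sumr_const card_ord -!mulr_sumr -/S -/Q -[X in _ + X - _]mulr_natl.
  ring.
lra.
Qed.

(** When the multiplier [d1 - i * d2] is large, it dominates the bounded
    perturbation [g + i * g']. *)
Lemma multiplier_dominates (d1 d2 : R) (p q g g' : 'I_n -> R) :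
  (d1 ^+ 2 + d2 ^+ 2) / 2 * (disagreement p + disagreement q)
    - (disagreement g + disagreement g') <=
  4 * n%:R * \sum_i ((d1 * p i + d2 * q i + g i) ^+ 2 +
                     (d1 * q i - d2 * p i + g' i) ^+ 2).
Proof.
rewrite big_split/= [leRHS]mulrDr.
have H := lerD (disagreement_le (fun i => d1 * p i + d2 * q i + g i))
  (disagreement_le (fun i => d1 * q i - d2 * p i + g' i)).
apply: le_trans H; rewrite /disagreement.
rewrite -!big_split/= mulr_sumr -sumrB; apply: ler_sum => i _.
rewrite -!big_split/= mulr_sumr -sumrB; apply: ler_sum => j _.
set P := p i - p j; set Q := q i - q j; set G := g i - g j; set G' := g' i - g' j.
have -> : d1 * p i + d2 * q i + g i - (d1 * p j + d2 * q j + g j) =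
  d1 * P + d2 * Q + G by rewrite /P /Q /G; ring.
have -> : d1 * q i - d2 * p i + g' i - (d1 * q j - d2 * p j + g' j) =
  d1 * Q - d2 * P + G' by rewrite /P /Q /G'; ring.
have := sqr_ge0 (d1 * P + d2 * Q + 2 * G).
have := sqr_ge0 (d1 * Q - d2 * P + 2 * G').
by rewrite !expr2; lra.
Qed.

Variables (a tau : 'I_n -> 'I_n -> R) (A : R).
Hypothesis aA : forall i j, `|a i j| <= A.

Let A_ge0 : (0 < n)%N -> 0 <= A.
Proof. by move=> n0; apply: le_trans (aA (Ordinal n0) (Ordinal n0)). Qed.

(** Each coefficient is the real part of a rotation of [(p i - p j) + i (q i - q j)],
    hence at most its modulus. *)
Lemma coupling_le (p q : 'I_n -> R) (al be : 'I_n -> 'I_n -> R) :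
  (forall i j, al i j ^+ 2 + be i j ^+ 2 = 1) ->
  disagreement (fun i => \sum_j a i j *
     (al i j * (p i - p j) + be i j * (q i - q j))) <=
  4 * n%:R ^+ 2 * A ^+ 2 * (disagreement p + disagreement q).
Proof.
move=> ab1; apply: (le_trans (disagreement_le _)).
have -> : 4 * n%:R ^+ 2 * A ^+ 2 * (disagreement p + disagreement q) =
  4 * n%:R * (n%:R * (A ^+ 2 * (disagreement p + disagreement q))) by ring.
rewrite ler_wpM2l ?mulr_ge0//.
apply: le_trans (_ : \sum_i n%:R * \sum_j (a i j *
     (al i j * (p i - p j) + be i j * (q i - q j))) ^+ 2 <= _).
  by apply: ler_sum => i _; exact: sqr_sum_le.
rewrite -mulr_sumr ler_wpM2l// -big_split/= mulr_sumr; apply: ler_sum => i _.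
rewrite -big_split/= mulr_sumr; apply: ler_sum => j _.
rewrite exprMn; apply: ler_pM; rewrite ?sqr_ge0//.
  by rewrite -[leLHS]real_normK ?num_real// ler_sqr ?nnegrE// (le_trans _ (aA i j)).
have := sqr_ge0 (al i j * (q i - q j) - be i j * (p i - p j)).
set P := p i - p j; set Q := q i - q j.
have -> : (al i j * Q - be i j * P) ^+ 2 =
  (al i j ^+ 2 + be i j ^+ 2) * (P ^+ 2 + Q ^+ 2) - (al i j * P + be i j * Q) ^+ 2.
  by ring.
by rewrite ab1; lra.
Qed.

Hypothesis uniform : forall W, 0 <= W -> exists2 e : R, 0 < e &
  forall w (v : 'I_n -> R), `|w| <= W -> e * disagreement v <=
    \sum_i \sum_j a i j * cos (tau i j * w) * (v i - v j) ^+ 2.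

(** With [F = p + i q], these are the real and the imaginary part of
    [(1 - exp (i th)) / h * F i + \sum_j a i j * exp (i m th) * (F i - F j)], the
    transform of the residual of the sampled equation. *)
Definition freq_res_re (h : R) (m : 'I_n -> 'I_n -> nat) th p q i :=
  h^-1 * (p i - (cos th * p i - sin th * q i)) +
  \sum_j a i j * (cos ((m i j)%:R * th) * (p i - p j)
                  - sin ((m i j)%:R * th) * (q i - q j)).

Definition freq_res_im (h : R) (m : 'I_n -> 'I_n -> nat) th p q i :=
  h^-1 * (q i - (sin th * p i + cos th * q i)) +
  \sum_j a i j * (sin ((m i j)%:R * th) * (p i - p j)
                  + cos ((m i j)%:R * th) * (q i - q j)).

Definition freq_energy (m : 'I_n -> 'I_n -> nat) th (p q : 'I_n -> R) :=
  \sum_i \sum_j a i j * cos ((m i j)%:R * th) *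
    ((p i - p j) ^+ 2 + (q i - q j) ^+ 2).

(** At low frequency the sampled delays [m h] are close enough to [tau] for
    the uniform bound to survive; at high frequency the difference quotient
    [(1 - exp(i th)) / h] is so large that the residual alone controls the
    disagreement, whatever the sign of the energy. *)
Lemma freq_bound_pi K : 0 < K -> exists2 e : R, 0 < e & exists2 h0 : R, 0 < h0 &
  forall h m, 0 < h < h0 -> (forall i j, `|(m i j)%:R * h - tau i j| <= h) ->
  forall th p q, `|th| <= pi -> e * (disagreement p + disagreement q) <=
    2^-1 * freq_energy m th p q +
    K * \sum_i (freq_res_re h m th p q i ^+ 2 + freq_res_im h m th p q i ^+ 2).
Proof.
move=> K0; have [n0|n_gt0] := posnP n.
  exists 1 => //; exists 1 => // h m _ _ th p q _.
  rewrite /disagreement /freq_energy.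
  by rewrite !big1 ?mulr0 ?addr0// => i; exfalso; case: i; rewrite n0.
have A0 := A_ge0 n_gt0; have n0 : (0 : R) < n%:R by rewrite ltr0n.
(* For [W <= |1 - exp(i th)|^2 / h^2], [K] times the residual outweighs the
   energy, which is at least [- A / 2] times the disagreement, and leaves a
   surplus of 1. *)
pose W : R := 2 * (8 * n%:R ^+ 2 * A ^+ 2 + 4 * n%:R / K * (A / 2 + 1)).
have W0 : 0 <= W.
  rewrite mulr_ge0// addr_ge0// ?mulr_ge0// ?sqr_ge0 ?exprn_ge0//.
    by rewrite ltW// invr_gt0.
  by rewrite addr_ge0// divr_ge0.
(* [w1 ^+ 2 / 4 >= W], without a square root. *)
pose w1 := 1 + 4 * W.
have w1_ge1 : 1 <= w1 by rewrite /w1; lra.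
have [|e1 e1_gt0 e1P] := @uniform w1; first lra.
exists (Num.min 1 (e1 / 4)); first by rewrite lt_min ltr01 divr_gt0.
have Aw1 : 0 <= A * w1 by rewrite mulr_ge0//; lra.
exists (Num.min w1^-1 (e1 / (2 * (A * w1 + 1)))).
  rewrite lt_min invr_gt0 (lt_le_trans ltr01)//= divr_gt0// mulr_gt0//; lra.
move=> h m /andP[h0]; rewrite lt_min => /andP[hw1 he1] mtau th p q thpi.
set V := disagreement p + disagreement q.
have V0 : 0 <= V by rewrite addr_ge0 ?disagreement_ge0.
have res_ge0 : 0 <= \sum_i (freq_res_re h m th p q i ^+ 2 + freq_res_im h m th p q i ^+ 2).
  by apply: sumr_ge0 => i _; rewrite addr_ge0 ?sqr_ge0.
have w1h : w1 * h <= 1.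
  by rewrite mulrC -ler_pdivlMr ?div1r ?ltW//; lra.
have [thl|thh] := leP `|th| (w1 * h).
  apply: (@le_trans _ _ (e1 / 4 * V)).
    by rewrite ler_wpM2r// ge_min lexx orbT.
  apply: ler_wpDr; first by rewrite mulr_ge0// ltW.
  have -> : e1 / 4 * V = 2^-1 * (e1 / 2 * V) by field.
  rewrite ler_pM2l ?invr_gt0//.
  pose w := th / h.
  have ww1 : `|w| <= w1 by rewrite normrM normfV (gtr0_norm h0) ler_pdivrMr.
  have cosB i j : `|cos ((m i j)%:R * th) - cos (tau i j * w)| <= w1 * h.
    apply: le_trans (cos_lipschitz _ _) _.
    have -> : (m i j)%:R * th - tau i j * w = ((m i j)%:R * h - tau i j) * w.
      by rewrite /w; field; exact: lt0r_neq0.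
    by rewrite normrM mulrC ler_pM.
  have low v : (e1 / 2) * disagreement v <=
      \sum_i \sum_j a i j * cos ((m i j)%:R * th) * (v i - v j) ^+ 2.
    have := e1P w v ww1.
    have : \sum_i \sum_j a i j * cos (tau i j * w) * (v i - v j) ^+ 2
       - A * w1 * h * disagreement v <=
      \sum_i \sum_j a i j * cos ((m i j)%:R * th) * (v i - v j) ^+ 2.
      rewrite /disagreement mulr_sumr -sumrB; apply: ler_sum => i _.
      rewrite mulr_sumr -sumrB; apply: ler_sum => j _.
      rewrite -mulrBl ler_wpM2r ?sqr_ge0//.
      rewrite lerBlDr -lerBlDl -mulrBr.
      apply: le_trans (ler_norm _) _; rewrite normrM -mulrA ler_pM//.
      by rewrite distrC.
    have : A * w1 * h * disagreement v <= e1 / 2 * disagreement v.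
      rewrite ler_wpM2r ?disagreement_ge0//.
      move: he1; rewrite ltr_pdivlMr ?mulr_gt0//; last lra.
      move=> he1; have -> : A * w1 * h = h * (A * w1) by ring.
      by rewrite ler_pdivlMr//; lra.
    by lra.
  rewrite /V /freq_energy mulrDr.
  apply: le_trans (lerD (low p) (low q)) _.
  rewrite -big_split/= le_eqVlt; apply/orP; left; apply/eqP; apply: eq_bigr => i _.
  by rewrite -big_split/=; apply: eq_bigr => j _; rewrite mulrDr.
apply: (@le_trans _ _ V).
  by rewrite ler_piMl// ge_min lexx.
have energyA : - (A * V) <= freq_energy m th p q.
  rewrite /V /freq_energy /disagreement -big_split/= -mulNr mulr_sumr.
  apply: ler_sum => i _; rewrite -big_split/= mulr_sumr; apply: ler_sum => j _.
  rewrite ler_wpM2r ?addr_ge0 ?sqr_ge0// lerNl.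
  apply: le_trans (ler_norm _) _; rewrite normrN normrM -[leRHS]mulr1.
  by rewrite ler_pM// cos_max.
pose d1 := h^-1 * (1 - cos th); pose d2 := h^-1 * sin th.
have d12 : W <= d1 ^+ 2 + d2 ^+ 2.
  have -> : d1 ^+ 2 + d2 ^+ 2 = 2 * (1 - cos th) / h ^+ 2.
    have := cos2Dsin2 th; rewrite /d1 /d2 => cs.
    rewrite !exprMn -mulrDr mulrC exprVn; congr (_ / _).
    by have := cs; rewrite !expr2; lra.
  rewrite ler_pdivlMr ?exprn_gt0// -cos_norm.
  have w1h0 : 0 <= w1 * h by rewrite mulr_ge0//; lra.
  have := cos_le_cos w1h0 (ltW thh) thpi.
  have := @one_sub_cos_ge R (w1 * h); rewrite w1h0 w1h => /(_ isT).
  have : 4 * W * h ^+ 2 <= (w1 * h) ^+ 2.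
    by rewrite exprMn ler_wpM2r ?exprn_ge0 ?ltW// /w1 expr2; nra.
  lra.
set res := \sum_i _ in res_ge0 *.
pose g i := \sum_j a i j * (cos ((m i j)%:R * th) * (p i - p j)
                  + - sin ((m i j)%:R * th) * (q i - q j)).
pose g' i := \sum_j a i j * (sin ((m i j)%:R * th) * (p i - p j)
                  + cos ((m i j)%:R * th) * (q i - q j)).
have := multiplier_dominates d1 d2 p q g g'.
have -> : \sum_i ((d1 * p i + d2 * q i + g i) ^+ 2 +
                  (d1 * q i - d2 * p i + g' i) ^+ 2) = res.
  apply: eq_bigr => i _; congr (_ ^+ 2 + _ ^+ 2).
    rewrite /freq_res_re; congr (_ + _); first by rewrite /d1 /d2; ring.
    by apply: eq_bigr => j _; rewrite mulNr.
  by rewrite /freq_res_im; congr (_ + _); rewrite /d1 /d2; ring.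
have := @coupling_le p q (fun i j => cos ((m i j)%:R * th))
  (fun i j => - sin ((m i j)%:R * th)).
move=> /(_ (fun i j => _))/wrap[]; first by move=> i j; rewrite sqrrN cos2Dsin2.
rewrite -/(disagreement g) -/V => gle.
have := @coupling_le p q (fun i j => sin ((m i j)%:R * th))
  (fun i j => cos ((m i j)%:R * th)).
move=> /(_ (fun i j => _))/wrap[]; first by move=> i j; rewrite addrC cos2Dsin2.
rewrite -/(disagreement g') -/V => g'le resle.
have W2 : W / 2 * V <= (d1 ^+ 2 + d2 ^+ 2) / 2 * V by rewrite ler_wpM2r// ler_pM2r.
have : 4 * n%:R / K * (A / 2 + 1) * V <= 4 * n%:R * res.
  have -> : 4 * n%:R / K * (A / 2 + 1) * V =
    W / 2 * V - 8 * n%:R ^+ 2 * A ^+ 2 * V by rewrite /W; field; exact: lt0r_neq0.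
  lra.
have -> : 4 * n%:R / K * (A / 2 + 1) * V = 4 * n%:R * ((A / 2 + 1) * V / K).
  by field; exact: lt0r_neq0.
rewrite ler_pM2l ?mulr_gt0// ler_pdivrMr// => resK.
by move: energyA resK; lra.
Qed.

(** The forms only see [th] through cosines and sines of integer multiples, so
    the range of [th] may be shifted by a full turn. *)
Lemma freq_bound K : 0 < K -> exists2 e : R, 0 < e & exists2 h0 : R, 0 < h0 &
  forall h m, 0 < h < h0 -> (forall i j, `|(m i j)%:R * h - tau i j| <= h) ->
  forall th p q, 0 <= th <= 2 * pi -> e * (disagreement p + disagreement q) <=
    2^-1 * freq_energy m th p q +
    K * \sum_i (freq_res_re h m th p q i ^+ 2 + freq_res_im h m th p q i ^+ 2).
Proof.
move=> /freq_bound_pi[e e0 [h0 h0_gt0 H]]; exists e => //; exists h0 => // h m hh mtau.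
move=> th p q /andP[th0 th2].
have [thpi|pith] := leP th pi; first by apply: H => //; rewrite ger0_norm.
have cosE k : cos (k%:R * (th - 2 * pi)) = cos (k%:R * th).
  by rewrite mulrBr cosB cos_mulnpi sin_mulnpi mulr1 mulr0 addr0.
have sinE k : sin (k%:R * (th - 2 * pi)) = sin (k%:R * th).
  by rewrite mulrBr sinB cos_mulnpi sin_mulnpi mulr1 mulr0 subr0.
have := H h m hh mtau (th - 2 * pi) p q.
have -> : `|th - 2 * pi| <= pi by rewrite ler_norml; apply/andP; split; lra.
move=> /(_ isT).
have -> : freq_energy m (th - 2 * pi) p q = freq_energy m th p q.
  by apply: eq_bigr => i _; apply: eq_bigr => j _; rewrite cosE.
have cos1E : cos (th - 2 * pi) = cos th by have := cosE 1%N; rewrite !mul1r.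
have sin1E : sin (th - 2 * pi) = sin th by have := sinE 1%N; rewrite !mul1r.
congr (_ <= _ + _ * _); apply: eq_bigr => i _.
rewrite /freq_res_re /freq_res_im cos1E sin1E.
by congr ((_ + _) ^+ 2 + (_ + _) ^+ 2); apply: eq_bigr => j _; rewrite cosE sinE.
Qed.

End FreqBound.

(** * The dissipation inequality in discrete time *)

Section DiscreteDissipation.
Variables (R : realType) (n : nat) (a tau : 'I_n -> 'I_n -> R) (A : R).
Hypothesis aA : forall i j, `|a i j| <= A.
Hypothesis uniform : forall W, 0 <= W -> exists2 e : R, 0 < e &
  forall w (v : 'I_n -> R), `|w| <= W -> e * disagreement v <=
    \sum_i \sum_j a i j * cos (tau i j * w) * (v i - v j) ^+ 2.

(** Twice the power that the delayed coupling takes out of the state. *)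
Definition time_energy (m : 'I_n -> 'I_n -> nat) (y : 'I_n -> nat -> R) t :=
  \sum_i \sum_j a i j * ((y i t - y j t) *
    rshift (m i j) (fun s => y i s - y j s) t).

(** The defect of [y] in the equation, with a backward difference quotient for
    the derivative. *)
Definition time_res (h : R) (m : 'I_n -> 'I_n -> nat) (y : 'I_n -> nat -> R) i t :=
  h^-1 * (y i t - rshift 1 (y i) t) +
  \sum_j a i j * rshift (m i j) (fun s => y i s - y j s) t.

Section Transform.
Variables (m : 'I_n -> 'I_n -> nat) (y : 'I_n -> nat -> R) (N : nat).
Hypothesis m_supp : forall i j k t, (N <= t + m i j)%N -> y k t = 0.
Hypothesis one_supp : forall k t, (N <= t + 1)%N -> y k t = 0.

Let p k i := csum N (y i) (freq R N k).
Let q k i := ssum N (y i) (freq R N k).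

Lemma parseval_sqr f : \sum_(k < N) (csum N f (freq R N k) ^+ 2 +
  ssum N f (freq R N k) ^+ 2) = N%:R * \sum_(t < N) f t ^+ 2.
Proof. by rewrite (parseval N f f). Qed.

Lemma parseval_disagreement :
  \sum_(k < N) (disagreement (p k) + disagreement (q k)) =
  N%:R * \sum_(t < N) disagreement (fun i => y i t).
Proof.
rewrite /disagreement; under eq_bigr do rewrite -big_split/=.
rewrite exchange_big [in RHS]exchange_big mulr_sumr/=; apply: eq_bigr => i _.
under eq_bigr do rewrite -big_split/=.
rewrite exchange_big [in RHS]exchange_big mulr_sumr/=; apply: eq_bigr => j _.
rewrite -(parseval_sqr (fun t => y i t - y j t)); apply: eq_bigr => k _.
by rewrite csumB ssumB.
Qed.

Let yB_supp i j k l t : (N <= t + m k l)%N -> y i t - y j t = 0.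
Proof. by move=> /m_supp y0; rewrite !y0 subrr. Qed.

(** The delays turn into rotations, of which the product with the undelayed
    coefficient keeps only the cosine. *)
Lemma parseval_energy : \sum_(k < N) freq_energy a m (freq R N k) (p k) (q k) =
  N%:R * \sum_(t < N) time_energy m y t.
Proof.
rewrite /time_energy /freq_energy.
rewrite exchange_big [in RHS]exchange_big mulr_sumr/=; apply: eq_bigr => i _.
rewrite exchange_big [in RHS]exchange_big mulr_sumr/=; apply: eq_bigr => j _.
rewrite -[in RHS]mulr_sumr [RHS]mulrCA.
rewrite -(parseval N (fun t => y i t - y j t) (rshift _ _)) mulr_sumr; apply: eq_bigr => k _.
rewrite -mulrA; congr (_ * _).
rewrite csum_rshift; last exact: yB_supp.
rewrite ssum_rshift; last exact: yB_supp.
by rewrite csumB ssumB -/(p k i) -/(p k j) -/(q k i) -/(q k j); ring.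
Qed.

Lemma parseval_res h : \sum_(k < N) \sum_i
    (freq_res_re a h m (freq R N k) (p k) (q k) i ^+ 2 +
     freq_res_im a h m (freq R N k) (p k) (q k) i ^+ 2) =
  N%:R * \sum_(t < N) \sum_i time_res h m y i t ^+ 2.
Proof.
rewrite exchange_big [in RHS]exchange_big mulr_sumr/=; apply: eq_bigr => i _.
rewrite -parseval_sqr; apply: eq_bigr => k _.
have supp1 : forall t, (N <= t + 1)%N -> y i t = 0 by move=> t; exact: one_supp.
rewrite /time_res csum_lin ssum_lin csumB ssumB.
rewrite (csum_rshift _ supp1) (ssum_rshift _ supp1) mul1r -/(p k i) -/(q k i).
congr ((_ + _) ^+ 2 + (_ + _) ^+ 2); apply: eq_bigr => j _.
  rewrite csum_rshift; last exact: yB_supp.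
  by rewrite csumB ssumB.
rewrite ssum_rshift; last exact: yB_supp.
by rewrite csumB ssumB.
Qed.

End Transform.

(** This is where the positivity of the frequency-domain Laplacians reaches the
    time domain: the inequality holds at each of the [N] frequencies, and
    Parseval's identity sums it.  The constants do not depend on [N], [h], or the
    signal. *)
Lemma discrete_dissipation K : 0 < K ->
  exists2 e : R, 0 < e & exists2 h0 : R, 0 < h0 &
  forall h m, 0 < h < h0 -> (forall i j, `|(m i j)%:R * h - tau i j| <= h) ->
  forall (N : nat) (y : 'I_n -> nat -> R),
  (forall i j k t, (N <= t + m i j)%N -> y k t = 0) ->
  (forall k t, (N <= t + 1)%N -> y k t = 0) ->
  e * \sum_(t < N) disagreement (fun i => y i t) <=
  2^-1 * \sum_(t < N) time_energy m y t +
  K * \sum_(t < N) \sum_i time_res h m y i t ^+ 2.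
Proof.
move=> /(freq_bound aA uniform)[e e0 [h0 h0_gt0 H]].
exists e => //; exists h0 => // h m hh mtau N y ms os.
have [->|N0] := posnP N; first by rewrite !big_ord0 !mulr0 addr0.
have NR : (0 : R) < N%:R by rewrite ltr0n.
rewrite -(ler_pM2l NR) mulrDr !(mulrCA N%:R).
rewrite -parseval_disagreement -(parseval_energy ms) -(parseval_res ms os).
rewrite !mulr_sumr -big_split/=; apply: ler_sum => k _.
apply: H => //; have kN : (k%:R : R) <= N%:R by rewrite ler_nat ltnW.
have pi0 := @pi_ge0 R.
rewrite /freq divr_ge0 ?mulr_ge0//=.
by rewrite ler_pdivrMr// ler_wpM2l// mulr_ge0.
Qed.

End DiscreteDissipation.

(** * Growth of absolutely continuous functions *)

Section Growth.
Variable R : realType.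
Notation mu := (@lebesgue_measure R).
Implicit Types (f : R -> R) (a b c k s x : R).

Lemma abs_continuous_sub a b a' b' f :
  a <= a' -> b' <= b -> abs_continuous a b f -> abs_continuous a' b' f.
Proof.
move=> aa bb fac e /fac[d d0 H]; exists d => // m u v uv; apply: H => i.
by have [? ? ?] := uv i; split=> //; [exact: le_trans aa _|exact: le_trans bb].
Qed.

Lemma abs_continuousN a b f :
  abs_continuous a b f -> abs_continuous a b (fun t => - f t).
Proof.
move=> fac e /fac[d d0 H]; exists d => // m u v uv dis /(H m u v uv dis).
by under eq_bigr do rewrite -normrN opprB -[f _]opprK addrC.
Qed.

Lemma abs_continuousD a b f g : abs_continuous a b f -> abs_continuous a b g ->
  abs_continuous a b (fun t => f t + g t).
Proof.
move=> fac gac e e0; have e2 : 0 < e / 2 by rewrite divr_gt0.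
have [d d0 Hf] := fac _ e2; have [d' d'0 Hg] := gac _ e2.
exists (Num.min d d'); first by rewrite lt_min d0.
move=> m u v uv dis; rewrite lt_min => /andP[/(Hf m u v uv dis) lef /(Hg m u v uv dis)].
move=> /(ltrD lef); rewrite -splitr; apply: le_lt_trans.
rewrite -big_split/=; apply: ler_sum => i _.
by rewrite opprD addrACA; exact: ler_normD.
Qed.

(** The certificate that a growth rate [c] is only exceeded, between [a] and
    [s], on finitely many disjoint intervals, which are charged to [U]. *)
Definition covered_growth f c (U : set R) a s := exists l : seq (R * R),
  [/\ {in l, forall p, [/\ a <= p.1, p.1 <= p.2 & p.2 <= s]},
      pairwise (fun p q => q.2 <= p.1) l,
      f s - f a <= c * (s - a) + \sum_(p <- l) (f p.2 - f p.1 - c * (p.2 - p.1)) &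
      ((\sum_(p <- l) (p.2 - p.1))%:E <= mu (U `&` `[a, s]))%E].

Section Chain.
Variables (f : R -> R) (c : R) (U : set R) (a : R).
Hypothesis openU : open U.

Let mUI s : measurable (U `&` `[a, s])%classic.
Proof. by apply: measurableI => //; exact: open_measurable. Qed.

Lemma covered_growth0 : covered_growth f c U a a.
Proof.
by exists [::]; split=> //; rewrite big_nil ?subrr ?mulr0 ?addr0//; exact: measure_ge0.
Qed.

Lemma covered_growth_good s s' : s <= s' -> f s' - f s <= c * (s' - s) ->
  covered_growth f c U a s -> covered_growth f c U a s'.
Proof.
move=> ss fss [l [l1 l2 l3 l4]]; exists l; split=> //.
- by move=> p /l1[? ? ?]; split=> //; exact: le_trans ss.
- by lra.
- apply: (le_trans l4); apply: le_measure; rewrite ?inE; [exact: mUI|exact: mUI|].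
  apply: setIS => x /=; rewrite !in_itv/= => /andP[-> /le_trans]; exact.
Qed.

Lemma covered_growth_bad s s' : a <= s -> s <= s' -> (`]s, s'] `<=` U)%classic ->
  covered_growth f c U a s -> covered_growth f c U a s'.
Proof.
move=> as_ ss sU [l [l1 l2 l3 l4]]; exists ((s, s') :: l); split=> //.
- move=> p; rewrite inE => /predU1P[->|/l1[? ? ?]]; split=> //.
  exact: le_trans ss.
- by rewrite /= l2 andbT; apply/allP => p /l1[].
- by rewrite big_cons/=; lra.
- rewrite big_cons/= EFinD addeC.
  apply: (@le_trans _ _ (mu ((U `&` `[a, s]) `|` `]s, s'])%classic)); last first.
    apply: le_measure; rewrite ?inE; [by apply: measurableU => //; exact: mUI|exact: mUI|].
    move=> x [[Ux]|/= xs]; last first.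
      split; first exact: sU.
      by move: xs; rewrite /= !in_itv/= => /andP[sx ->]; rewrite (le_trans as_ (ltW sx)).
    by rewrite /= !in_itv/= => /andP[ax xs]; split=> //; rewrite ax (le_trans xs).
  have disj : ((U `&` `[a, s]) `&` `]s, s'] = set0)%classic.
    rewrite -subset0 => x [[_ /=]]; rewrite !in_itv/= => /andP[_ xs] /andP[].
    by rewrite ltNge xs.
  rewrite measureU; [|exact: mUI|by []|exact: disj].
  have -> : ((s' - s)%:E = mu `]s, s']%classic)%E.
    rewrite lebesgue_measure_itv/= lte_fin; case: ltgtP ss => // ->.
    by rewrite subrr.
  exact: leeD.
Qed.

(** A point has a neighbourhood across which certificates extend. *)
Definition extensible b x := exists2 r : R, 0 < r & forall s s',
  a <= s -> s' <= b -> x - r < s -> s <= x -> x <= s' -> s' < x + r ->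
  covered_growth f c U a s -> covered_growth f c U a s'.

Lemma extensible_open b x : U x -> extensible b x.
Proof.
move=> Ux; have /nbhs_ballP[r /= r0 rU] : nbhs x U by exact: open_nbhs_nbhs.
exists r => // s s' as_ s'b xrs sx xs' s'r; apply: covered_growth_bad => //.
  exact: le_trans sx xs'.
move=> y /=; rewrite in_itv/= => /andP[sy ys']; apply: rU.
by rewrite /ball/= ltr_norml; apply/andP; split; lra.
Qed.

Lemma extensible_derive b x d : is_derive x 1 f d -> d < c -> extensible b x.
Proof.
move=> [dfx dE] dc.
have : (h^-1 *: (f (h + x) - f x) @[h --> 0^'] --> d)%classic.
  by rewrite -dE; have := dfx; rewrite /derivable /derive /=; under eq_fun do rewrite [_ *: 1]mulr1.
move=> /cvgrPdist_lt/(_ (c - d)); rewrite subr_gt0 => /(_ dc).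
rewrite near_withinE => /nbhs_ballP[r /= r0 rH].
exists r => // s s' _ _ xrs sx xs' s'r; apply: covered_growth_good; first exact: le_trans xs'.
have quot y : `|y - x| < r -> y != x -> (f y - f x) / (y - x) < c.
  move=> yr yx; have := rH (y - x).
  rewrite /ball/= sub0r normrN => /(_ yr); rewrite subr_eq0 => /(_ yx).
  rewrite subrK ltr_norml /GRing.scale/= mulrC => /andP[? _]; lra.
have right : f s' - f x <= c * (s' - x).
  have [->|xs'_neq] := eqVneq s' x; first by rewrite !subrr mulr0.
  have s'x : 0 < s' - x by rewrite subr_gt0 lt_def xs'_neq.
  by rewrite -ler_pdivrMr// ltW// quot// ger0_norm ?ltW//; lra.
have left : f x - f s <= c * (x - s).
  have [->|sx_neq] := eqVneq s x; first by rewrite !subrr mulr0.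
  have xs : 0 < x - s by rewrite subr_gt0 lt_def eq_sym sx_neq.
  have := quot s; rewrite distrC (ger0_norm (ltW xs)) => /(_ _ sx_neq).
  rewrite -[s - x]opprB -[f s - f x]opprB invrN mulrNN ltr_pdivrMr//.
  by move=> /(_ _)/ltW; apply; lra.
lra.
Qed.

Lemma covered_growth_all b : a <= b -> (forall x, a <= x <= b -> extensible b x) ->
  covered_growth f c U a b.
Proof.
move=> ab ext; pose S := [set s | a <= s <= b /\ covered_growth f c U a s]%classic.
have Sa : S a by split; [rewrite lexx ab|exact: covered_growth0].
have ubS : ubound S b by move=> s [/andP[]].
have supS : has_sup S by split; [exists a|exists b].
have asup : a <= sup S by apply: sup_upper_bound.
have supb : sup S <= b by apply: ge_sup => //; exists a.
have [|r r0 rP] := ext (sup S); first by rewrite asup.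
have [s [/andP[as_ sb] cs] ss] := sup_adherent r0 supS.
have ssup : s <= sup S by apply: sup_upper_bound => //; split=> //; rewrite as_.
have step s' : s' <= b -> sup S <= s' -> s' < sup S + r -> covered_growth f c U a s'.
  by move=> *; apply: (rP s).
have [supltb|bsup] := ltP (sup S) b; last by apply: step => //; rewrite (le_lt_trans bsup)// ltrDl.
pose s' := Num.min (sup S + r / 2) b.
have s'b : s' <= b by rewrite ge_min lexx orbT.
have sups' : sup S < s' by rewrite lt_min supltb andbT ltrDl divr_gt0.
have s'r : s' < sup S + r by rewrite gt_min; apply/orP; left; lra.
have : s' <= sup S.
  apply: sup_upper_bound => //; split; last by apply: step => //; exact: ltW.
  by rewrite s'b (le_trans asup)// ltW.
by rewrite leNgt sups'.
Qed.

End Chain.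

(** An absolutely continuous function grows no faster than its almost
    everywhere derivative allows: the points where nothing is known are covered
    by an open set of small measure, and absolute continuity makes the total
    growth across the intervals charged to this set negligible. *)
Lemma ae_derive_le_growth f a b k : a <= b -> abs_continuous a b f ->
  {ae mu, forall t, a < t < b -> exists2 d, is_derive t 1 f d & d <= k} ->
  f b - f a <= k * (b - a).
Proof.
move=> ab fac [N [mN N0 NP]].
suff key (e : R) : 0 < e -> f b - f a <= (k + e) * (b - a) + 2 * e.
  apply/ler_addgt0Pr => e e0; have ba : 0 < b - a + 2 by rewrite ltr_wpDl ?subr_ge0.
  have := key (e / (b - a + 2)); rewrite divr_gt0// => /(_ isT)/le_trans; apply.
  rewrite le_eqVlt; apply/orP; left; apply/eqP; field; exact: lt0r_neq0.
move=> e0; set c := k + e.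
have [d d0 dP] := fac _ e0.
(* The first bound controls the variation of [f], the second that of [c * t]. *)
pose d' := Num.min d (e / (`|c| + 1)).
have d'0 : 0 < d' by rewrite lt_min d0 divr_gt0// ltr_wpDl.
(* The derivative at the end points is unknown as well. *)
pose N' := (N `|` [set a; b])%classic.
have mN' : measurable N' by apply: measurableU => //; apply: measurableU.
have muN' : mu N' = 0%E.
  have mab : measurable [set a; b]%classic by exact: measurableU.
  have N'le : (mu N' <= mu N + mu [set a; b]%classic)%E by exact: measureU2.
  have able : (mu [set a; b]%classic <= mu [set a]%classic + mu [set b]%classic)%E.
    exact: measureU2.
  apply/eqP; rewrite -measure_le0; apply: le_trans N'le _.
  have -> : mu N = 0%E by exact: N0.
  by rewrite add0e; move: able; rewrite !lebesgue_measure_set1 adde0.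
have N'fin : (mu N' < +oo)%E by rewrite muN' ltry.
have [U [oU NU muU]] := @lebesgue_regularity_outer R N' d' mN' N'fin d'0.
have {muU} muU : (mu U < d'%:E)%E.
  have mUN : measurable (U `\` N')%classic.
    by apply: measurableD => //; exact: open_measurable.
  have : (mu (N' `|` (U `\` N'))%classic <= mu N' + mu (U `\` N')%classic)%E.
    exact: measureU2.
  rewrite setDUK// muN' add0e => /le_lt_trans; apply.
  exact: muU.
have [|l [l1 l2 l3 l4]] := @covered_growth_all f c U a b ab.
  move=> x /andP[ax xb]; have [Ux|nUx] := pselect (U x).
    exact: extensible_open.
  have [d1 fd d1k] : exists2 d, is_derive x 1 f d & d <= k.
    apply: contrapT => nder; apply: nUx; apply: NU.
    have [xa|xa] := eqVneq x a; first by right; left.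
    have [xb'|xb'] := eqVneq x b; first by right; right.
    left; apply: NP => /= H; apply: nder; apply: H.
    by rewrite !lt_def xa eq_sym xb' ax.
  by apply: (extensible_derive _ oU _ fd); rewrite /c; lra.
have sum_lt : \sum_(p <- l) (p.2 - p.1) < d'.
  rewrite -lte_fin; apply: le_lt_trans l4 (le_lt_trans _ muU).
  apply: le_measure; rewrite ?inE//; first by apply: measurableI => //; exact: open_measurable.
  exact: open_measurable.
pose u (i : 'I_(size l)) := (nth (0, 0) l i).1; pose v (i : 'I_(size l)) := (nth (0, 0) l i).2.
have sumE (F : R * R -> R) : \sum_(p <- l) F p = \sum_(i < size l) F (u i, v i).
  by rewrite (big_nth (0, 0)) big_mkord; apply: eq_bigr => i _; rewrite -surjective_pairing.
have := dP _ u v.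
have -> : \sum_k0 (v k0 - u k0) < d.
  by move: sum_lt; rewrite sumE/= lt_min => /andP[].
move=> H; have {}H : \sum_k0 `|f (v k0) - f (u k0)| < e.
  apply: H => // [i|i j ij]; first exact/l1/mem_nth.
  move/(pairwiseP (0, 0)): l2 => l2.
  have [ij'|ji|eij] := ltngtP i j.
  - by right; apply: l2 => //; rewrite inE.
  - by left; apply: l2 => //; rewrite inE.
  - by case/eqP: ij; exact/val_inj.
have sum_f : \sum_(p <- l) (f p.2 - f p.1) <= e.
  rewrite sumE/= ltW// (le_lt_trans _ H)//; apply: ler_sum => i _; exact: ler_norm.
have sum_c : - (c * \sum_(p <- l) (p.2 - p.1)) <= e.
  apply: le_trans (ler_norm _) _; rewrite normrN normrM (ger0_norm (x := \sum_(p <- l) _)).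
    move: sum_lt; rewrite lt_min => /andP[_]; rewrite ltr_pdivlMr ?ltr_wpDl// => sl.
    have s0 : 0 <= \sum_(p <- l) (p.2 - p.1).
      by rewrite big_seq; apply: sumr_ge0 => p /l1[_ ? _]; rewrite subr_ge0.
    by move: sl s0; rewrite mulrDr mulr1 mulrC; lra.
  by rewrite big_seq; apply: sumr_ge0 => p /l1[_ ? _]; rewrite subr_ge0.
move: l3; rewrite sumrB -mulr_sumr; move: sum_f sum_c; rewrite /=; lra.
Qed.

Lemma ae_derive_growth f a b c k : a <= b -> abs_continuous a b f ->
  {ae mu, forall t, a < t < b -> exists2 d, is_derive t 1 f d & `|d - c| <= k} ->
  `|f b - f a - c * (b - a)| <= k * (b - a).
Proof.
move=> ab fac H; rewrite ler_norml; apply/andP; split.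
  have := @ae_derive_le_growth (fun t => - f t) a b (k - c) ab (abs_continuousN fac).
  have /[swap]/[apply] : {ae mu, forall t, a < t < b ->
      exists2 d, is_derive t 1 (fun t => - f t) d & d <= k - c}.
    apply: negligibleS H => t /= Ht1 Ht2; apply: Ht1 => /Ht2[d fd].
    by rewrite ler_norml => /andP[? ?]; exists (- d); [exact: is_deriveN|lra].
  lra.
have := @ae_derive_le_growth f a b (c + k) ab fac.
have /[swap]/[apply] : {ae mu, forall t, a < t < b -> exists2 d, is_derive t 1 f d & d <= c + k}.
  apply: negligibleS H => t /= Ht1 Ht2; apply: Ht1 => /Ht2[d fd].
  by rewrite ler_norml => /andP[? ?]; exists d => //; lra.
lra.
Qed.

End Growth.

(** * Indicators of intervals on a grid, and a ramp *)

Section Ramp.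
Variables (R : realType) (d T : R).
Hypotheses (d0 : 0 < d) (dT : d <= T).

Definition ind (l r s : R) : R := ((l <= s <= r)%R : bool)%:R.

Lemma ind_ge0 l r s : 0 <= ind l r s. Proof. exact: ler0n. Qed.

Lemma ind_le1 l r s : ind l r s <= 1. Proof. by rewrite -[1]/(1%:R) ler_nat leq_b1. Qed.

Lemma ind1 l r s : l <= s -> s <= r -> ind l r s = 1.
Proof. by rewrite /ind => -> ->. Qed.

Lemma ind_sqr l r s : ind l r s ^+ 2 = ind l r s.
Proof. by rewrite /ind; case: (_ <= _ <= _); rewrite ?expr1n ?expr0n. Qed.

(** Each grid point in [[l, r]] accounts for an increment [h] of the truncation
    of [s] to [[l, r + h]]. *)
Lemma sum_ind_le h l r N : 0 < h -> l <= r ->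
  h * \sum_(t < N) ind l r (t%:R * h) <= r - l + h.
Proof.
move=> h0 lr; pose cl s := Num.min (Num.max s l) (r + h).
have step (t : nat) : h * ind l r (t%:R * h) <= cl (t.+1%:R * h) - cl (t%:R * h).
  have -> : t.+1%:R * h = t%:R * h + h by rewrite -natr1 mulrDl mul1r.
  set s := t%:R * h; rewrite /ind; case: (boolP (l <= s <= r)) => [/andP[ls sr]|_].
    rewrite mulr1 /cl (max_l ls) (max_l (ler_wpDr (ltW h0) ls)).
    have -> : Num.min (s + h) (r + h) = s + h by apply: min_l; rewrite lerD2r.
    have -> : Num.min s (r + h) = s by apply: min_l; lra.
    lra.
  rewrite mulr0 subr_ge0 /cl le_min !ge_min lexx orbT andbT.
  by apply/orP; left; rewrite ge_max !le_max lexx orbT andbT lerDl (ltW h0).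
rewrite mulr_sumr (le_trans (ler_sum _ (fun (i : 'I_N) _ => step i)))//.
rewrite -(big_mkord xpredT (fun t => cl (t.+1%:R * h) - cl (t%:R * h))).
rewrite telescope_sumr//.
have l_le : l <= cl (0%:R * h) by rewrite le_min le_max lexx orbT/= ler_wpDr// ltW.
have : cl (N%:R * h) <= r + h by rewrite ge_min lexx orbT.
by move: l_le; lra.
Qed.

Definition ramp (s : R) : R :=
  Num.max 0 (Num.min 1 (Num.min (s / d) ((T + d - s) / d))).

Lemma ramp_ge0 s : 0 <= ramp s. Proof. by rewrite le_max lexx. Qed.

Lemma ramp_le1 s : ramp s <= 1. Proof. by rewrite ge_max ler01/= ge_min lexx. Qed.

Lemma ramp_left s : s <= 0 -> ramp s = 0.
Proof.
move=> s0; apply/max_l; rewrite !ge_min; apply/orP; right; apply/orP; left.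
by rewrite ler_pdivrMr// mul0r.
Qed.

Lemma ramp_right s : T + d <= s -> ramp s = 0.
Proof.
move=> s0; apply/max_l; rewrite !ge_min; apply/orP; right; apply/orP; right.
by rewrite ler_pdivrMr// mul0r subr_le0.
Qed.

Lemma ramp1 s : d <= s -> s <= T -> ramp s = 1.
Proof.
move=> ds sT; rewrite /ramp min_l ?max_r//.
by rewrite le_min !ler_pdivlMr// mul1r ds; lra.
Qed.

Lemma ramp_lipschitz s u : `|ramp s - ramp u| <= `|s - u| / d.
Proof.
wlog su : s u / s <= u => [th|].
  by have [/th//|/ltW/th] := leP s u; rewrite distrC [`|u - _|]distrC.
have k0 : 0 <= (u - s) / d by rewrite divr_ge0 ?subr_ge0// ltW.
rewrite [`|s - u|]distrC (ger0_norm (x := u - s)) ?subr_ge0//.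
have e1 : u / d = s / d + (u - s) / d by field; exact: lt0r_neq0.
have e2 : (T + d - s) / d = (T + d - u) / d + (u - s) / d by field; exact: lt0r_neq0.
rewrite /ramp e1 e2; move: k0; set k := (u - s) / d; set x := s / d; set y := (T + d - u) / d.
move=> k0; rewrite ler_norml.
rewrite /Num.max /Num.min.
do ![case: ifP => /=]; move=> *; apply/andP; split;
  repeat match goal with H : (_ < _) = false |- _ => move/negbT: H; rewrite -leNgt => H end; lra.
Qed.

End Ramp.

(** * Energy balance of a sampled and cut-off solution *)

Section SampledSolution.
Variables (R : realType) (n : nat) (a tau : 'I_n -> 'I_n -> R).
Variables (z : 'I_n -> R -> R) (A : R).
Implicit Types (i j : 'I_n) (s t u c k : R).
Hypotheses (A0 : 0 <= A) (aA : forall i j, `|a i j| <= A).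
Hypothesis aC : forall i j, a i j = a j i.
Hypothesis past : forall i s, s < 0 -> z i s = 0.
(** The equation in integrated form: [z i] moves between [s] and [t] at the
    average rate [c], up to [k], when its right-hand side stays within [k] of [c]. *)
Hypothesis growth : forall i s t c k, 0 <= s -> s <= t ->
  (forall u, s < u -> u < t ->
    `|\sum_j a i j * (z j (u - tau i j) - z i (u - tau i j)) - c| <= k) ->
  `|z i t - z i s - c * (t - s)| <= k * (t - s).

Variables (M T1 : R).
Hypothesis M0 : 0 <= M.
Hypothesis zM : forall i s, 0 <= s -> s <= T1 -> `|z i s| <= M.
Hypothesis tau_ge0 : forall i j, 0 <= tau i j.

Let lip := 2 * n%:R * A * M.

Let zd i j s := z i s - z j s.

Lemma sum_le_const (F : 'I_n -> R) c : (forall i, F i <= c) -> \sum_i F i <= n%:R * c.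
Proof.
move=> Fc; apply: (le_trans (ler_sum _ (fun i _ => Fc i))).
by rewrite sumr_const card_ord [leRHS]mulr_natl.
Qed.

Lemma zd_le i j s : s <= T1 -> `|zd i j s| <= 2 * M.
Proof.
have M_ge0 := M0.
move=> sT; have [s0|s0] := ltP s 0; first by rewrite /zd !past// subrr normr0 mulr_ge0.
have := zM i s0 sT; have := zM j s0 sT; have := ler_normB (z i s) (z j s).
by rewrite /zd; lra.
Qed.

Let lip_ge0 : 0 <= lip. Proof. by rewrite !mulr_ge0. Qed.

Lemma sampled_lipschitz i s t : 0 <= s -> s <= t -> t <= T1 ->
  `|z i t - z i s| <= lip * (t - s).
Proof.
have M_ge0 := M0.
move=> s0 st tT; have := @growth i s t 0 lip s0 st; rewrite mul0r !subr0; apply=> u su ut.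
rewrite subr0; apply: le_trans (ler_norm_sum _ _ _) _.
have -> : lip = n%:R * (A * (2 * M)) by rewrite /lip; ring.
apply: sum_le_const => j; rewrite normrM; apply: ler_pM => //.
by apply: zd_le; have := tau_ge0 i j; lra.
Qed.

Lemma zd_lipschitz i j s t : 0 <= s -> s <= t -> t <= T1 ->
  `|zd i j t - zd i j s| <= 2 * lip * (t - s).
Proof.
have M_ge0 := M0.
move=> s0 st tT; have := sampled_lipschitz i s0 st tT; have := sampled_lipschitz j s0 st tT.
have := ler_normB (z i t - z i s) (z j t - z j s).
have -> : zd i j t - zd i j s = z i t - z i s - (z j t - z j s) by rewrite /zd; ring.
lra.
Qed.

Lemma sqr_lipschitz s t : 0 <= s -> s <= t -> t <= T1 ->
  `|\sum_i z i s ^+ 2 - \sum_i z i t ^+ 2| <= n%:R * (2 * M * lip * (t - s)).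
Proof.
have M_ge0 := M0.
move=> s0 st tT; rewrite -sumrB; apply: le_trans (ler_norm_sum _ _ _) _.
apply: sum_le_const => i; rewrite subr_sqr normrM mulrC -mulrA; apply: ler_pM => //.
  have := zM i s0 (le_trans st tT); have := zM i (le_trans s0 st) tT.
  have := ler_normD (z i s) (z i t); lra.
by rewrite distrC; exact: sampled_lipschitz.
Qed.

(** The delays [mu] stand for [tau] rounded down to multiples of the step [h]. *)
Variables (h : R) (mu : 'I_n -> 'I_n -> R).
Hypothesis h0 : 0 < h.
Hypothesis mu_ge0 : forall i j, 0 <= mu i j.
Hypothesis mu_le : forall i j, mu i j <= tau i j.
Hypothesis mu_gt : forall i j, tau i j < mu i j + h.
Hypothesis muC : forall i j, mu i j = mu j i.

Let flow i s := \sum_j a i j * zd i j (s - mu i j).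

Let err i s := z i s - z i (s - h) + h * flow i s.

(** Bounds the error of one Euler step, divided by [h]. *)
Let eta i s :=
  \sum_j A * (4 * lip * h * ind 0 T1 s + 4 * M * ind (mu i j) (mu i j + 2 * h) s).

Lemma eta_ge0 i s : 0 <= eta i s.
Proof.
apply: sumr_ge0 => j _; rewrite mulr_ge0// addr_ge0// mulr_ge0 ?ind_ge0//.
  by rewrite !mulr_ge0// ltW.
by rewrite mulr_ge0.
Qed.

(** One step of the sampled solution is an Euler step up to [O(h ^ 2)], except
    for the few steps during which a delayed argument crosses the jump at 0. *)
Lemma err_le i s : h <= s -> s <= T1 -> `|err i s| <= h * eta i s.
Proof.
have [hp M_ge0] := (h0, M0).
move=> hs sT; have s0 : 0 <= s by lra.
have sh0 : 0 <= s - h by lra.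
have shs : s - h <= s by lra.
have := @growth i (s - h) s (- flow i s) (eta i s) sh0 shs.
have -> : s - (s - h) = h by ring.
have -> : z i s - z i (s - h) - - flow i s * h = err i s by rewrite /err; ring.
rewrite mulrC; apply=> u su us; rewrite opprK -big_split/=.
apply: le_trans (ler_norm_sum _ _ _) _; apply: ler_sum => j _.
rewrite (ind1 s0 sT) mulr1.
have -> : a i j * (z j (u - tau i j) - z i (u - tau i j)) + a i j * zd i j (s - mu i j)
  = a i j * (zd i j (s - mu i j) - zd i j (u - tau i j)) by rewrite /zd; ring.
rewrite normrM; apply: ler_pM => //.
have m0 := mu_ge0 i j; have ml := mu_le i j; have mg := mu_gt i j.
have lh : 0 <= 4 * lip * h by rewrite !mulr_ge0// ltW.
have Mi : 0 <= 4 * M * ind (mu i j) (mu i j + 2 * h) s by rewrite mulr_ge0 ?ind_ge0 ?mulr_ge0.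
have [smu|mus] := ltP s (mu i j).
  have -> : zd i j (s - mu i j) = 0 by rewrite /zd !past ?subrr//; lra.
  have -> : zd i j (u - tau i j) = 0 by rewrite /zd !past ?subrr//; lra.
  by rewrite subrr normr0 addr_ge0.
have [smu|mus2] := leP s (mu i j + 2 * h).
  rewrite (ind1 mus smu) mulr1.
  have c1 : s - mu i j <= T1 by lra.
  have c2 : u - tau i j <= T1 by lra.
  have := zd_le i j c1; have := zd_le i j c2.
  have := ler_normB (zd i j (s - mu i j)) (zd i j (u - tau i j)); lra.
have c1 : 0 <= u - tau i j by lra.
have c2 : u - tau i j <= s - mu i j by lra.
have c3 : s - mu i j <= T1 by lra.
have le1 := zd_lipschitz i j c1 c2 c3.
have : 2 * lip * (s - mu i j - (u - tau i j)) <= 2 * lip * (2 * h).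
  by rewrite ler_wpM2l ?mulr_ge0//; lra.
lra.
Qed.

Variables (d T : R).
Hypotheses (d0 : 0 < d) (dT : d <= T) (d1 : d <= 1) (hd : h <= d) (T1E : T1 = T + 1).

Let phi := ramp d T.

Lemma phi_right s : T + d <= s -> phi s = 0.
Proof. by move=> ?; rewrite /phi ramp_right. Qed.

Lemma phi_one s : d <= s -> s <= T -> phi s = 1.
Proof. by move=> ? ?; rewrite /phi ramp1. Qed.

Lemma phi_left s : s <= 0 -> phi s = 0.
Proof. by move=> ?; rewrite /phi ramp_left. Qed.

Lemma phi_err_le i s : h <= s -> phi s * `|err i s| <= h * eta i s.
Proof.
have [[[hp dp] dTp] [d1p hdp]] := (h0, d0, dT, (d1, hd)); have M_ge0 := M0.
move=> hs; have [sT|Ts] := leP (T + d) s.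
  by rewrite (phi_right sT) mul0r mulr_ge0 ?eta_ge0 ?ltW.
apply: le_trans (@err_le i s hs _); last by rewrite T1E; lra.
by rewrite ler_piMl// /phi ramp_le1.
Qed.

Lemma ramp_dist s u : `|phi s - phi u| <= 1.
Proof.
have [[[hp dp] dTp] [d1p hdp]] := (h0, d0, dT, (d1, hd)); have M_ge0 := M0.
have := ramp_ge0 d T s; have := ramp_ge0 d T u; have := ramp_le1 d T s.
by have := ramp_le1 d T u; rewrite -/phi ler_norml => *; apply/andP; split; lra.
Qed.

(** The cut-off commutes with the delay except when it changes between
    [s - mu i j] and [s]: then either the delayed time is on the rising ramp, or
    the present time is on the falling one; a delayed time before 0 contributes
    nothing. *)
Lemma comm_le i j s : phi s * `|phi (s - mu i j) - phi s| * `|zd i j (s - mu i j)|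
  <= 2 * M * (ind (mu i j) (mu i j + d) s + ind T (T + d) s).
Proof.
have [[[hp dp] dTp] [d1p hdp]] := (h0, d0, dT, (d1, hd)); have M_ge0 := M0.
have m0 := mu_ge0 i j.
have i1 := ind_ge0 (mu i j) (mu i j + d) s; have i2 := ind_ge0 T (T + d) s.
have rhs0 : 0 <= 2 * M * (ind (mu i j) (mu i j + d) s + ind T (T + d) s).
  by rewrite mulr_ge0 ?mulr_ge0 ?addr_ge0.
have [smu|mus] := ltP s (mu i j).
  have -> : zd i j (s - mu i j) = 0 by rewrite /zd !past ?subrr//; lra.
  by rewrite normr0 mulr0.
have [Tds|sTd] := ltP (T + d) s; first by rewrite (phi_right (ltW Tds)) !mul0r.
have [phi1|phiN] := eqVneq (phi (s - mu i j)) (phi s).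
  by rewrite phi1 subrr normr0 mulr0 mul0r.
have le2M : phi s * `|phi (s - mu i j) - phi s| * `|zd i j (s - mu i j)| <= 2 * M.
  rewrite -[leRHS]mul1r; apply: ler_pM => //.
  - by rewrite mulr_ge0 ?ramp_ge0.
  - by rewrite mulr_ile1 ?ramp_ge0 ?ramp_le1 ?ramp_dist.
  - by apply: zd_le; rewrite T1E; lra.
apply: le_trans le2M _; rewrite -[leLHS]mulr1 ler_wpM2l ?mulr_ge0//.
have [?|?] := leP s (mu i j + d); first by rewrite ind1// lerDl ind_ge0.
have [?|?] := leP T s; first by rewrite (@ind1 _ T)// lerDr ind_ge0.
by case/eqP: phiN; rewrite !phi_one//; lra.
Qed.

Let y i s := phi s * z i s.

Let energy s := \sum_i \sum_j a i j *
  ((y i s - y j s) * (y i (s - mu i j) - y j (s - mu i j))).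

Let res i s := h^-1 * (y i s - y i (s - h)) +
  \sum_j a i j * (y i (s - mu i j) - y j (s - mu i j)).

Let qs s := \sum_i z i s ^+ 2.

(** Delaying the cut-off together with the solution only produces the commutator
    in the second term. *)
Lemma energy_split s : 2^-1 * energy s =
  phi s ^+ 2 * \sum_i z i s * flow i s +
  2^-1 * \sum_i \sum_j a i j * (zd i j s *
    (phi s * (phi (s - mu i j) - phi s) * zd i j (s - mu i j))).
Proof.
have -> : \sum_i z i s * flow i s = 2^-1 * \sum_i \sum_j a i j * (zd i j s * zd i j (s - mu i j)).
  rewrite -(@sum_antisym _ _ a (fun i => z i s) (fun i j => zd i j (s - mu i j)))//.
    by rewrite -[X in _ = _ * X]mulr_natl mulKf.
  by move=> i j; rewrite muC opprB.
rewrite mulrCA -mulrDr; congr (_ * _); rewrite mulr_sumr -big_split/=.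
apply: eq_bigr => i _; rewrite mulr_sumr -big_split/=; apply: eq_bigr => j _.
by rewrite /y /zd; ring.
Qed.

Lemma energy_left s : s <= 0 -> energy s = 0.
Proof.
move=> s0; rewrite /energy big1// => i _; rewrite big1// => j _.
by rewrite /y (phi_left s0) !mul0r subrr mul0r mulr0.
Qed.

Lemma res_left i s : s <= 0 -> res i s = 0.
Proof.
have [[[hp dp] dTp] [d1p hdp]] := (h0, d0, dT, (d1, hd)); have M_ge0 := M0.
move=> s0; rewrite /res /y (phi_left s0) (@phi_left (s - h)); last by lra.
rewrite !mul0r subrr mulr0 add0r big1// => j _.
rewrite (@phi_left (s - mu i j)) ?mul0r ?subrr ?mulr0//.
by have := mu_ge0 i j; lra.
Qed.

(** The coupling is traded for the difference quotient by means of the equation,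
    and [z * (z s - z (s - h))] is at least half the increment of [z ^+ 2].  Where
    the cut-off is 1 the increments will telescope; elsewhere they are [O(h)]. *)
Lemma energy_le s : h <= s -> h * (2^-1 * energy s) <=
  M * (h * \sum_i eta i s)
  + 2^-1 * (ind h T s * (qs (s - h) - qs s))
  + n%:R * (M * lip * h) * (ind 0 d s + ind T (T + d) s)
  + h * (2 * A * M ^+ 2 *
     \sum_i \sum_j (ind (mu i j) (mu i j + d) s + ind T (T + d) s)).
Proof.
have [[[hp dp] dTp] [d1p hdp]] := (h0, d0, dT, (d1, hd)); have M_ge0 := M0.
move=> hs; have s0 : 0 <= s by lra.
have phi0 : 0 <= phi s by exact: ramp_ge0.
have phi1 : phi s <= 1 by exact: ramp_le1.
have zMphi i : phi s * `|z i s| <= M.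
  have [sT|Ts] := leP (T + d) s; first by rewrite (phi_right sT) mul0r.
  by rewrite -[M]mul1r; apply: ler_pM => //; apply: zM => //; rewrite T1E; lra.
have q_le : phi s ^+ 2 * (2^-1 * (qs (s - h) - qs s)) <=
    2^-1 * (ind h T s * (qs (s - h) - qs s)) +
    n%:R * (M * lip * h) * (ind 0 d s + ind T (T + d) s).
  rewrite mulrCA -lerBlDl -mulrBr -mulrBl.
  have [sT|Ts] := leP (T + d) s.
    rewrite (phi_right sT) expr0n/= sub0r; have [Ts|sT'] := ltP T s.
      have -> : ind h T s = 0 by rewrite /ind [s <= T]leNgt Ts andbF.
      rewrite oppr0 mul0r mulr0.
      by rewrite mulr_ge0 ?addr_ge0 ?ind_ge0// !mulr_ge0// ltW.
    by lra.
  have sT1 : s <= T1 by rewrite T1E; lra.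
  have shs : s - h <= s by lra.
  have sh0 : 0 <= s - h by lra.
  have := sqr_lipschitz sh0 shs sT1; rewrite -/(qs _) -/(qs s).
  have -> : s - (s - h) = h by ring.
  move=> qle; have i1 := ind_ge0 0 d s; have i2 := ind_ge0 T (T + d) s.
  have i3 : `|phi s ^+ 2 - ind h T s| <= ind 0 d s + ind T (T + d) s.
    have phi2 : 0 <= phi s ^+ 2 <= 1 by rewrite sqr_ge0 exprn_ile1.
    have ih : 0 <= ind h T s <= 1 by rewrite ind_ge0 ind_le1.
    have [sd|ds] := leP s d.
      by rewrite [ind 0 d s]ind1//; rewrite ler_norml; apply/andP; split; lra.
    have [sT'|Ts'] := ltP s T.
      rewrite (ind1 hs (ltW sT')) (phi_one (ltW ds) (ltW sT')) expr1n subrr normr0; lra.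
    rewrite (ind1 Ts' (ltW Ts)).
    by rewrite ler_norml; apply/andP; split; lra.
  apply: le_trans (_ : 2^-1 * (`|phi s ^+ 2 - ind h T s| * `|qs (s - h) - qs s|) <= _).
    by rewrite ler_pM2l ?invr_gt0// -normrM ler_norm.
  have -> : n%:R * (M * lip * h) * (ind 0 d s + ind T (T + d) s) =
     2^-1 * ((ind 0 d s + ind T (T + d) s) * (n%:R * (2 * M * lip * h))) by field.
  by rewrite ler_pM2l ?invr_gt0//; apply: ler_pM.
have step : h * (phi s ^+ 2 * \sum_i z i s * flow i s) <=
     M * (h * \sum_i eta i s) +
     phi s ^+ 2 * (2^-1 * (qs (s - h) - qs s)).
  rewrite /qs -sumrB !mulr_sumr -big_split/=; apply: ler_sum => i _.
  have -> : h * (phi s ^+ 2 * (z i s * flow i s)) =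
    phi s ^+ 2 * (z i s * err i s + z i s * (z i (s - h) - z i s)).
    by rewrite /err; ring.
  apply: (@le_trans _ _ (phi s * `|z i s| * (phi s * `|err i s|) +
     phi s ^+ 2 * (2^-1 * (z i (s - h) ^+ 2 - z i s ^+ 2)))).
    have -> : phi s * `|z i s| * (phi s * `|err i s|) = phi s ^+ 2 * `|z i s * err i s|.
      by rewrite normrM; ring.
    rewrite -[leRHS]mulrDr ler_wpM2l ?sqr_ge0//; have := ler_norm (z i s * err i s).
    have := sqr_ge0 (z i s - z i (s - h)); rewrite !expr2; lra.
  rewrite lerD2r ler_pM//.
  - by rewrite mulr_ge0.
  - by rewrite mulr_ge0.
  - exact: phi_err_le.
have comm : \sum_i \sum_j a i j * (zd i j s *
    (phi s * (phi (s - mu i j) - phi s) * zd i j (s - mu i j))) <=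
  2 * (2 * A * M ^+ 2 *
     \sum_i \sum_j (ind (mu i j) (mu i j + d) s + ind T (T + d) s)).
  rewrite !mulr_sumr; apply: ler_sum => i _; rewrite !mulr_sumr; apply: ler_sum => j _.
  have -> : 2 * (2 * A * M ^+ 2 * (ind (mu i j) (mu i j + d) s + ind T (T + d) s)) =
    A * (2 * M * (2 * M * (ind (mu i j) (mu i j + d) s + ind T (T + d) s))) by ring.
  have [sT|Ts] := ltP (T + d) s.
    rewrite (phi_right (ltW sT)) !mul0r mulr0 mulr0.
    by rewrite !mulr_ge0// addr_ge0// ind_ge0.
  apply: le_trans (ler_norm _) _; rewrite normrM; apply: ler_pM => //.
  rewrite normrM; apply: ler_pM => //; first by apply: zd_le; rewrite T1E; lra.
  by rewrite !normrM (ger0_norm phi0); exact: comm_le.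
rewrite energy_split mulrDr.
have := ler_wpM2l (ltW h0) comm.
move: step q_le; lra.
Qed.

(** The residual of the cut-off solution comes from the Euler error, from the
    slope [1 / d] of the ramps, and from the commutator with the delays. *)
Lemma res_le i s : h <= s -> `|res i s| <= eta i s +
    M / d * (ind 0 (d + h) s + ind T (T + d + h) s) +
    \sum_j A * (2 * M * (ind (mu i j) (mu i j + d) s + ind T (T + d + mu i j) s)).
Proof.
have [[[hp dp] dTp] [d1p hdp]] := (h0, d0, dT, (d1, hd)); have M_ge0 := M0.
move=> hs; have s0 : 0 <= s by lra.
have hV0 : 0 <= h^-1 by rewrite invr_ge0 ltW.
have -> : res i s = h^-1 * (phi s * err i s) +
    h^-1 * (phi s - phi (s - h)) * z i (s - h) +
    \sum_j a i j * ((phi (s - mu i j) - phi s) * zd i j (s - mu i j)).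
  rewrite /res; have -> : \sum_j a i j * (y i (s - mu i j) - y j (s - mu i j)) =
    phi s * flow i s + \sum_j a i j * ((phi (s - mu i j) - phi s) * zd i j (s - mu i j)).
    rewrite mulr_sumr -big_split/=; apply: eq_bigr => j _.
    by rewrite /y /zd; ring.
  by rewrite addrA; congr (_ + _); rewrite /y /err; field; exact: lt0r_neq0.
apply: le_trans (ler_normD _ _) _; apply: lerD.
  apply: le_trans (ler_normD _ _) _; apply: lerD.
    rewrite !normrM (ger0_norm hV0).
    rewrite ler_pdivrMl// (ger0_norm (x := phi s)) ?ramp_ge0//.
    exact: phi_err_le.
  have rhs0 : 0 <= M / d * (ind 0 (d + h) s + ind T (T + d + h) s).
    by rewrite mulr_ge0 ?divr_ge0 ?addr_ge0 ?ind_ge0// ltW.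
  have [phi1|phiN] := eqVneq (phi s) (phi (s - h)).
    by rewrite phi1 subrr mulr0 mul0r normr0.
  have [sT|Ts] := ltP (T + d + h) s.
    by case/eqP: phiN; rewrite !phi_right//; lra.
  apply: (@le_trans _ _ (M / d)).
    rewrite !normrM (ger0_norm hV0) mulrC; apply: ler_pM => //.
      by rewrite mulr_ge0.
      by apply: zM; rewrite ?T1E; lra.
    rewrite ler_pdivrMl//; have := ramp_lipschitz T d0 s (s - h).
    have -> : s - (s - h) = h by ring.
    by rewrite (ger0_norm (ltW h0)).
  have Md : 0 <= M / d by rewrite divr_ge0// ltW.
  rewrite -[leLHS]mulr1 ler_wpM2l//.
  have [?|?] := leP s (d + h); first by rewrite ind1// lerDl ind_ge0.
  have [?|?] := leP T s; first by rewrite (@ind1 _ T)// lerDr ind_ge0.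
  by case/eqP: phiN; rewrite !phi_one//; lra.
apply: le_trans (ler_norm_sum _ _ _) _; apply: ler_sum => j _.
rewrite normrM; apply: ler_pM => //; rewrite normrM.
have m0 := mu_ge0 i j.
have [smu|mus] := ltP s (mu i j).
  have -> : zd i j (s - mu i j) = 0 by rewrite /zd !past ?subrr//; lra.
  by rewrite normr0 mulr0 !mulr_ge0 ?addr_ge0 ?ind_ge0.
have [phi1|phiN] := eqVneq (phi (s - mu i j)) (phi s).
  by rewrite phi1 subrr normr0 mul0r !mulr_ge0 ?addr_ge0 ?ind_ge0.
have [sT|Ts] := ltP (T + d + mu i j) s.
  by case/eqP: phiN; rewrite !phi_right//; lra.
apply: (@le_trans _ _ (1 * (2 * M))).
  by apply: ler_pM; rewrite ?ramp_dist// zd_le// T1E; lra.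
rewrite mul1r -[leLHS]mulr1 ler_wpM2l ?mulr_ge0//.
have [?|?] := leP s (mu i j + d); first by rewrite ind1// lerDl ind_ge0.
have [?|?] := leP T s; first by rewrite (@ind1 _ T)// lerDr ind_ge0.
by case/eqP: phiN; rewrite !phi_one//; lra.
Qed.

(** The bound [hT] makes all sampling errors on [[0, T]] at most of order [d]. *)
Variables (D : R) (N q : nat).
Hypotheses (tauD : forall i j, tau i j <= D) (D0 : 0 <= D).
Hypotheses (TE : T = q%:R * h) (qN : (q < N)%N) (hT : h * (T + 2) <= d).

Let hsum (F : R -> R) := h * \sum_(t < N) F (t%:R * h).

Let hsumD F F' : hsum (fun s => F s + F' s) = hsum F + hsum F'.
Proof. by rewrite /hsum big_split/= mulrDr. Qed.

Let hsumZ c F : hsum (fun s => c * F s) = c * hsum F.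
Proof. by rewrite /hsum -mulr_sumr mulrCA. Qed.

Let hsum_sum (F : 'I_n -> R -> R) :
  hsum (fun s => \sum_j F j s) = \sum_j hsum (F j).
Proof. by rewrite /hsum exchange_big/= mulr_sumr. Qed.

Let hsum_ind l r : l <= r -> hsum (ind l r) <= r - l + h.
Proof. exact: sum_ind_le. Qed.

Let a0 := n%:R * A.

Lemma hsum_eta i : hsum (eta i) <= M * d * (a0 * (8 * a0 + 12)).
Proof.
rewrite hsum_sum.
have -> : M * d * (a0 * (8 * a0 + 12)) =
    n%:R * (A * (4 * lip * d + 4 * M * (3 * d))) by rewrite /lip /a0; ring.
have T_ge0 : 0 <= T by apply: le_trans dT; exact: ltW.
have [[hp hTd] hdp] := (h0, hT, hd); have M_ge0 := M0.
apply: sum_le_const => j; rewrite hsumZ hsumD !hsumZ; apply: ler_wpM2l => //.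
apply: lerD.
  rewrite -!mulrA !ler_wpM2l//.
  have T1_ge0 : 0 <= T1 by rewrite T1E; lra.
  apply: (@le_trans _ _ (h * (T1 - 0 + h))); first by rewrite ler_pM2l// hsum_ind.
  by apply: le_trans hTd; rewrite ler_pM2l// T1E; have := d1; lra.
rewrite ler_wpM2l ?mulr_ge0//.
by apply: le_trans (hsum_ind _) _; lra.
Qed.

Lemma telescope_grid (Q : R -> R) :
  \sum_(t < N) ind h T (t%:R * h) * (Q (t%:R * h - h) - Q (t%:R * h)) = Q 0 - Q T.
Proof.
rewrite -(big_mkord xpredT (fun t : nat => ind h T (t%:R * h) * (Q (t%:R * h - h) - Q (t%:R * h)))).
rewrite (big_cat_nat (n := q.+1))//= [X in _ + X]big_nat_cond [X in _ + X]big1 ?addr0.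
  rewrite big_nat_recl//= mul0r [X in X + _](_ : _ = 0) ?add0r; last first.
    by rewrite /ind leNgt h0 mul0r.
  rewrite TE (eq_big_nat _ _ (F2 := fun t : nat => - (Q (t.+1%:R * h) - Q (t%:R * h)))).
    by rewrite sumrN telescope_sumr// mul0r opprB.
  move=> t /andP[_ tq]; rewrite ind1 ?mul1r.
  - have -> : t.+1%:R * h - h = t%:R * h by rewrite -natr1; ring.
    by rewrite opprB.
  - by rewrite ler_peMl ?ler1n// ltW.
  - by rewrite ler_pM2r// ler_nat.
move=> t /andP[/andP[qt _] _]; rewrite /ind [_ <= T]leNgt TE ltr_pM2r// ltr_nat qt.
by rewrite andbF mul0r.
Qed.

Lemma hsum_energy : hsum (fun s => 2^-1 * energy s) <=
  2^-1 * (qs 0 - qs T) + M ^+ 2 * d * (n%:R * a0 * (8 * a0 + 28)).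
Proof.
have [[[hp dp] dTp] [d1p hdp]] := (h0, d0, dT, (d1, hd)); have M_ge0 := M0.
have lip0 := lip_ge0.
have T_ge0 : 0 <= T by apply: le_trans dT; exact: ltW.
pose F s := M * (h * \sum_i eta i s)
  + 2^-1 * (ind h T s * (qs (s - h) - qs s))
  + n%:R * (M * lip * h) * (ind 0 d s + ind T (T + d) s)
  + h * (2 * A * M ^+ 2 *
     \sum_i \sum_j (ind (mu i j) (mu i j + d) s + ind T (T + d) s)).
have pt (t : nat) : h * (2^-1 * energy (t%:R * h)) <= F (t%:R * h).
  have [->|t0] := posnP t; last by apply: energy_le; rewrite ler_peMl ?ler1n// ltW.
  rewrite mul0r energy_left// mulr0 mulr0 /F {1}/ind [h <= 0]leNgt h0 mul0r mulr0 addr0.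
  have hw := ltW h0.
  have s1 : 0 <= \sum_i eta i 0 by apply: sumr_ge0 => i _; exact: eta_ge0.
  have s2 : 0 <= \sum_i \sum_j (ind (mu i j) (mu i j + d) 0 + ind T (T + d) 0).
    by apply: sumr_ge0 => i _; apply: sumr_ge0 => j _; rewrite addr_ge0 ?ind_ge0.
  have s3 : 0 <= ind 0 d 0 + ind T (T + d) 0 by rewrite addr_ge0 ?ind_ge0.
  rewrite addr_ge0 ?addr_ge0 ?(mulr_ge0 _ s3)//.
  - by rewrite !mulr_ge0.
  - by rewrite !mulr_ge0.
  - by rewrite !mulr_ge0// sqr_ge0.
rewrite /hsum mulr_sumr; apply: le_trans (ler_sum _ (fun (t : 'I_N) _ => pt t)) _.
rewrite /F !big_split/= -!mulr_sumr telescope_grid.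
have e1 : h * \sum_(t < N) \sum_i eta i (t%:R * h) <= n%:R * (M * d * (a0 * (8 * a0 + 12))).
  by rewrite -/(hsum (fun s => \sum_i eta i s)) hsum_sum; apply: sum_le_const; exact: hsum_eta.
have e2 : h * \sum_(t < N) (ind 0 d (t%:R * h) + ind T (T + d) (t%:R * h)) <= 4 * d.
  rewrite -/(hsum (fun s => ind 0 d s + ind T (T + d) s)) hsumD.
  have := @hsum_ind 0 d (ltW d0); have := @hsum_ind T (T + d).
  by rewrite lerDl (ltW d0) => /(_ isT); lra.
have e3 : h * \sum_(t < N) \sum_i \sum_j (ind (mu i j) (mu i j + d) (t%:R * h)
     + ind T (T + d) (t%:R * h)) <= n%:R * (n%:R * (4 * d)).
  rewrite -/(hsum (fun s => \sum_i \sum_j (ind (mu i j) (mu i j + d) s + ind T (T + d) s))).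
  rewrite hsum_sum; apply: sum_le_const => i; rewrite hsum_sum; apply: sum_le_const => j.
  rewrite hsumD; have := @hsum_ind (mu i j) (mu i j + d); have := @hsum_ind T (T + d).
  by rewrite !lerDl (ltW d0) => /(_ isT) ? /(_ isT) ?; lra.
have e1' := ler_wpM2l M_ge0 e1.
have e2' := ler_wpM2l (_ : 0 <= n%:R * (M * lip)) e2.
have e3' := ler_wpM2l (_ : 0 <= 2 * A * M ^+ 2) e3.
have {}e2' := e2' (mulr_ge0 (ler0n _ _) (mulr_ge0 M_ge0 lip0)).
have {}e3' := e3' (mulr_ge0 (mulr_ge0 (ler0n _ _) A0) (sqr_ge0 _)).
set S2 := \sum_(t < N) (_ + _) in e2' *; set S3 := \sum_(t < N) \sum_i \sum_j _ in e3' *.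
have -> : n%:R * (M * lip * h) * S2 = n%:R * (M * lip) * (h * S2) by ring.
have -> : h * (2 * A * M ^+ 2 * S3) = 2 * A * M ^+ 2 * (h * S3) by ring.
have -> : 2^-1 * (qs 0 - qs T) + M ^+ 2 * d * (n%:R * a0 * (8 * a0 + 28)) =
  M * (n%:R * (M * d * (a0 * (8 * a0 + 12)))) + 2^-1 * (qs 0 - qs T) +
  n%:R * (M * lip) * (4 * d) + 2 * A * M ^+ 2 * (n%:R * (n%:R * (4 * d))).
  by rewrite /lip /a0; ring.
by apply: lerD => //; apply: lerD => //; apply: lerD.
Qed.

(** Indicators are idempotent, so squaring the previous bound keeps its shape. *)
Lemma res_sqr_le i s : h <= s -> res i s ^+ 2 <=
  3 * (n%:R * \sum_j A ^+ 2 * (32 * (lip * h) ^+ 2 * ind 0 T1 s +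
                               32 * M ^+ 2 * ind (mu i j) (mu i j + 2 * h) s)
    + 2 * (M / d) ^+ 2 * (ind 0 (d + h) s + ind T (T + d + h) s)
    + n%:R * \sum_j 8 * A ^+ 2 * M ^+ 2 *
       (ind (mu i j) (mu i j + d) s + ind T (T + d + mu i j) s)).
Proof.
move=> hs; have := @res_le i s hs.
have ind2 l r l' r' : (ind l r s + ind l' r' s) ^+ 2 <= 2 * (ind l r s + ind l' r' s).
  have := ind_sqr l r s; have := ind_sqr l' r' s; rewrite !expr2.
  have := sqr_ge0 (ind l r s - ind l' r' s); rewrite !expr2; lra.
set E := eta i s; set U := M / d * _; set W := \sum_j A * (2 * M * _).
have E0 : 0 <= E by exact: eta_ge0.
have U0 : 0 <= U by rewrite mulr_ge0 ?divr_ge0 ?addr_ge0 ?ind_ge0// ltW.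
have W0 : 0 <= W.
  by apply: sumr_ge0 => j _; rewrite !mulr_ge0 ?addr_ge0 ?ind_ge0.
move=> resle; apply: (@le_trans _ _ ((E + U + W) ^+ 2)).
  by rewrite -[leLHS]real_normK ?num_real// ler_sqr ?nnegrE ?addr_ge0.
apply: (@le_trans _ _ (3 * (E ^+ 2 + U ^+ 2 + W ^+ 2))).
  have := sqr_ge0 (E - U); have := sqr_ge0 (E - W); have := sqr_ge0 (U - W).
  by rewrite !expr2; lra.
rewrite ler_pM2l//; apply: lerD; first apply: lerD.
- apply: le_trans (sqr_sum_le _) _; rewrite ler_wpM2l//; apply: ler_sum => j _.
  rewrite exprMn ler_wpM2l ?sqr_ge0//.
  set x := ind 0 T1 s; set x' := ind _ _ s.
  have xx : x * x = x by rewrite -expr2 ind_sqr.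
  have xx' : x' * x' = x' by rewrite -expr2 ind_sqr.
  have := sqr_ge0 (4 * lip * h * x - 4 * M * x').
  have -> : (4 * lip * h * x - 4 * M * x') ^+ 2 = 16 * (lip * h) ^+ 2 * (x * x) -
     2 * (4 * lip * h * x) * (4 * M * x') + 16 * M ^+ 2 * (x' * x') by ring.
  have -> : (4 * lip * h * x + 4 * M * x') ^+ 2 = 16 * (lip * h) ^+ 2 * (x * x) +
     2 * (4 * lip * h * x) * (4 * M * x') + 16 * M ^+ 2 * (x' * x') by ring.
  by rewrite xx xx'; lra.
- have -> : U ^+ 2 = (M / d) ^+ 2 * (ind 0 (d + h) s + ind T (T + d + h) s) ^+ 2.
    by rewrite exprMn.
  by rewrite (mulrC 2) -[leRHS]mulrA ler_wpM2l ?sqr_ge0.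
- apply: le_trans (sqr_sum_le _) _; rewrite ler_wpM2l//; apply: ler_sum => j _.
  have -> : 8 * A ^+ 2 * M ^+ 2 * (ind (mu i j) (mu i j + d) s + ind T (T + d + mu i j) s)
    = (2 * A * M) ^+ 2 * (2 * (ind (mu i j) (mu i j + d) s + ind T (T + d + mu i j) s)).
    by ring.
  have -> : (A * (2 * M * (ind (mu i j) (mu i j + d) s + ind T (T + d + mu i j) s))) ^+ 2
    = (2 * A * M) ^+ 2 * (ind (mu i j) (mu i j + d) s + ind T (T + d + mu i j) s) ^+ 2.
    by ring.
  by rewrite ler_wpM2l ?sqr_ge0.
Qed.

(** The ramps contribute a term of order [d * (1 / d) ^+ 2], which the factor
    [d ^+ 2] compensates. *)
Lemma hsum_res : d ^+ 2 * hsum (fun s => \sum_i res i s ^+ 2) <=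
  M ^+ 2 * d * (3 * n%:R * (32 * a0 ^+ 2 * (4 * a0 ^+ 2 + 3) + 12 + 8 * a0 ^+ 2 * (4 + D))).
Proof.
have [[[hp dp] dTp] [d1p hdp]] := (h0, d0, dT, (d1, hd)); have M_ge0 := M0.
have lip0 := lip_ge0; have hTd := hT.
have T_ge0 : 0 <= T by apply: le_trans dT; exact: ltW.
have [c1 c2 c3] : [/\ (0 : R) <= 32, (0 : R) <= 8 & (0 : R) <= 2] by split.
pose F i s := 3 * (n%:R * \sum_j A ^+ 2 * (32 * (lip * h) ^+ 2 * ind 0 T1 s +
                               32 * M ^+ 2 * ind (mu i j) (mu i j + 2 * h) s)
    + 2 * (M / d) ^+ 2 * (ind 0 (d + h) s + ind T (T + d + h) s)
    + n%:R * \sum_j 8 * A ^+ 2 * M ^+ 2 *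
       (ind (mu i j) (mu i j + d) s + ind T (T + d + mu i j) s)).
have F0 i s : 0 <= F i s.
  rewrite /F mulr_ge0// !addr_ge0// mulr_ge0 ?addr_ge0 ?ind_ge0//.
  - apply: sumr_ge0 => j _; rewrite mulr_ge0 ?sqr_ge0// addr_ge0// mulr_ge0 ?ind_ge0//.
      by rewrite mulr_ge0 ?sqr_ge0.
    by rewrite mulr_ge0 ?sqr_ge0.
  - by rewrite mulr_ge0 ?sqr_ge0.
  - apply: sumr_ge0 => j _; rewrite mulr_ge0 ?addr_ge0 ?ind_ge0//.
    by rewrite mulr_ge0 ?sqr_ge0 ?mulr_ge0 ?sqr_ge0.
have -> : M ^+ 2 * d * (3 * n%:R * (32 * a0 ^+ 2 * (4 * a0 ^+ 2 + 3) + 12 + 8 * a0 ^+ 2 * (4 + D)))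
  = n%:R * (3 * (M ^+ 2 * d * (32 * a0 ^+ 2 * (4 * a0 ^+ 2 + 3) + 12 + 8 * a0 ^+ 2 * (4 + D)))).
  by ring.
rewrite hsum_sum mulr_sumr; apply: sum_le_const => i.
apply: (@le_trans _ _ (d ^+ 2 * hsum (F i))).
  rewrite ler_pM2l ?exprn_gt0// ler_pM2l//; apply: ler_sum => t _.
  have [t0|t0] := posnP t; last by apply: res_sqr_le; rewrite ler_peMl ?ler1n// ltW.
  by rewrite t0 mul0r res_left// expr0n.
rewrite /F hsumZ mulrCA ler_pM2l// !hsumD !hsumZ !hsum_sum hsumD.
have b1 : \sum_j hsum (fun s => A ^+ 2 * (32 * (lip * h) ^+ 2 * ind 0 T1 s +
      32 * M ^+ 2 * ind (mu i j) (mu i j + 2 * h) s)) <=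
    n%:R * (A ^+ 2 * (32 * lip ^+ 2 + 32 * M ^+ 2 * 3)).
  apply: sum_le_const => j; rewrite hsumZ hsumD !hsumZ ler_wpM2l ?sqr_ge0// lerD//.
    set X := hsum _.
    have -> : 32 * (lip * h) ^+ 2 * X = 32 * lip ^+ 2 * (h ^+ 2 * X) by ring.
    rewrite -[leRHS]mulr1 ler_wpM2l ?mulr_ge0 ?sqr_ge0//.
    have T1_ge0 : 0 <= T1 by rewrite T1E; lra.
    apply: (@le_trans _ _ (h ^+ 2 * (T1 - 0 + h))).
      by rewrite ler_wpM2l ?sqr_ge0// hsum_ind.
    have h1 : h <= 1 by lra.
    have hT1 : h * (T1 - 0 + h) <= 1.
      by apply: le_trans (le_trans hTd d1p); rewrite ler_pM2l// T1E; lra.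
    have hT0 : 0 <= h * (T1 - 0 + h) by rewrite mulr_ge0//; lra.
    by rewrite expr2 -mulrA mulr_ile1// ltW.
  rewrite ler_wpM2l ?mulr_ge0 ?sqr_ge0//; apply: le_trans (hsum_ind _) _; lra.
have b2 : hsum (ind 0 (d + h)) + hsum (ind T (T + d + h)) <= 6 * d.
  have := @hsum_ind 0 (d + h); have := @hsum_ind T (T + d + h).
  have -> : T <= T + d + h by lra.
  have -> : 0 <= d + h by lra.
  by move=> /(_ isT) ? /(_ isT) ?; lra.
have b3 : \sum_j hsum (fun s => 8 * A ^+ 2 * M ^+ 2 *
       (ind (mu i j) (mu i j + d) s + ind T (T + d + mu i j) s)) <=
    n%:R * (8 * A ^+ 2 * M ^+ 2 * (4 + D)).
  apply: sum_le_const => j; rewrite hsumZ hsumD ler_wpM2l ?mulr_ge0 ?sqr_ge0//.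
  have m0 := mu_ge0 i j; have mD := le_trans (mu_le i j) (tauD i j).
  have := @hsum_ind (mu i j) (mu i j + d); have := @hsum_ind T (T + d + mu i j).
  have -> : T <= T + d + mu i j by lra.
  have -> : mu i j <= mu i j + d by lra.
  by move=> /(_ isT) ? /(_ isT) ?; lra.
have n0 : (0 : R) <= n%:R by [].
have := ler_wpM2l n0 b1; have := ler_wpM2l n0 b3.
have Md0 : 0 <= 2 * (M / d) ^+ 2 by rewrite mulr_ge0 ?sqr_ge0.
have := ler_wpM2l Md0 b2.
set X1 := n%:R * (\sum_j hsum _); set X3 := n%:R * (\sum_j hsum _).
set X2 := 2 * (M / d) ^+ 2 * (_ + _) => le2 le3 le1.
apply: (@le_trans _ _ (d ^+ 2 * (n%:R * (n%:R * (A ^+ 2 * (32 * lip ^+ 2 + 32 * M ^+ 2 * 3)))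
   + 2 * (M / d) ^+ 2 * (6 * d) + n%:R * (n%:R * (8 * A ^+ 2 * M ^+ 2 * (4 + D)))))).
  by rewrite ler_pM2l ?exprn_gt0//; apply: lerD => //; exact: lerD.
have -> : d ^+ 2 * (n%:R * (n%:R * (A ^+ 2 * (32 * lip ^+ 2 + 32 * M ^+ 2 * 3)))
   + 2 * (M / d) ^+ 2 * (6 * d) + n%:R * (n%:R * (8 * A ^+ 2 * M ^+ 2 * (4 + D)))) =
  M ^+ 2 * d * (d * (32 * a0 ^+ 2 * (4 * a0 ^+ 2 + 3) + 8 * a0 ^+ 2 * (4 + D)) + 12).
  by rewrite /lip /a0; field; exact: lt0r_neq0.
have Md1 : 0 <= M ^+ 2 * d by rewrite mulr_ge0 ?sqr_ge0// ltW.
rewrite ler_wpM2l//.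
set K := 32 * a0 ^+ 2 * _; set K' := 8 * a0 ^+ 2 * _.
have K0 : 0 <= K by rewrite !mulr_ge0 ?sqr_ge0// addr_ge0// mulr_ge0 ?sqr_ge0.
have K'0 : 0 <= K' by rewrite !mulr_ge0 ?sqr_ge0// addr_ge0.
have : d * (K + K') <= K + K' by rewrite ler_piMl// addr_ge0.
lra.
Qed.

End SampledSolution.

(** * The energy estimate *)

Section EnergyEstimate.
Variables (R : realType) (n : nat) (a tau : 'I_n -> 'I_n -> R).
Variables (z : 'I_n -> R -> R) (A D : R).
Implicit Types (i j : 'I_n) (s t u c k h d T M : R).
Hypotheses (A0 : 0 <= A) (aA : forall i j, `|a i j| <= A).
Hypothesis aC : forall i j, a i j = a j i.
Hypothesis tau_ge0 : forall i j, 0 <= tau i j.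
Hypothesis tauC : forall i j, tau i j = tau j i.
Hypotheses (tauD : forall i j, tau i j <= D) (D0 : 0 <= D).
Hypothesis past : forall i s, s < 0 -> z i s = 0.
Hypothesis growth : forall i s t c k, 0 <= s -> s <= t ->
  (forall u, s < u -> u < t ->
    `|\sum_j a i j * (z j (u - tau i j) - z i (u - tau i j)) - c| <= k) ->
  `|z i t - z i s - c * (t - s)| <= k * (t - s).
Hypothesis uniform : forall W, 0 <= W -> exists2 e : R, 0 < e &
  forall w (v : 'I_n -> R), `|w| <= W -> e * disagreement v <=
    \sum_i \sum_j a i j * cos (tau i j * w) * (v i - v j) ^+ 2.

Definition energy_cst : R := let a0 := n%:R * A in
  n%:R * a0 * (8 * a0 + 28) +
  3 * n%:R * (32 * a0 ^+ 2 * (4 * a0 ^+ 2 + 3) + 12 + 8 * a0 ^+ 2 * (4 + D)).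

(** The dissipation inequality, with the residual weighted by [d ^+ 2], is applied
    to the solution sampled with a small step and cut off by ramps of length [d].
    The error is proportional to [d] uniformly in [T], while [e] depends on [d]:
    small [d] bounds the norm of the solution, and [d = 1] then bounds the total
    disagreement. *)
Lemma energy_estimate d : 0 < d -> d <= 1 -> exists2 e : R, 0 < e &
  forall T M, d <= T -> 0 <= M ->
    (forall i s, 0 <= s -> s <= T + 1 -> `|z i s| <= M) ->
  exists2 h1 : R, 0 < h1 & forall h q, 0 < h -> h < h1 -> T = q%:R * h ->
    e * (h * \sum_(t < q.+1) ind d T (t%:R * h) *
               disagreement (fun i => z i (t%:R * h))) <=
    2^-1 * (\sum_i z i 0 ^+ 2 - \sum_i z i T ^+ 2) + energy_cst * M ^+ 2 * d.
Proof.
move=> d0 d1; have d2 : 0 < d ^+ 2 by rewrite exprn_gt0.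
have [e e0 [h0 h0_gt0 dissip]] := discrete_dissipation aA uniform d2.
exists e => // T M dT M0 zM; have T2 : 0 < T + 2 by lra.
exists (Num.min h0 (d / (T + 2))); first by rewrite lt_min h0_gt0 divr_gt0.
move=> h q hp; rewrite lt_min ltr_pdivlMr// => /andP[hh0 hT] TE.
have hd : h <= d by have : h * 1 <= h * (T + 2) by [rewrite ler_pM2l//; lra]; lra.
pose m i j := Num.truncn (tau i j / h); pose mu i j := (m i j)%:R * h.
have mu_ge0 i j : 0 <= mu i j by rewrite mulr_ge0// ltW.
have tauh i j : 0 <= tau i j / h by rewrite divr_ge0// ltW.
have mu_le i j : mu i j <= tau i j by rewrite -ler_pdivlMr// truncn_le.
have mu_gt i j : tau i j < mu i j + h.
  have := truncnS_gt (tau i j / h); rewrite ltr_pdivrMr// -natr1 mulrDl mul1r.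
  exact.
have muC i j : mu i j = mu j i by rewrite /mu /m tauC.
pose y i s := ramp d T s * z i s.
pose mx := \max_i \max_j m i j.
(* Beyond the end of the cut-off by more than the largest delay. *)
pose N := (q + Num.truncn ((T + d) / h) + mx + 2)%N.
have qN : (q < N)%N by rewrite /N addn2 ltnS -addnA leqW// leq_addr.
have m_le i j : (m i j <= mx)%N.
  apply: leq_trans (leq_bigmax j) _.
  exact: (@leq_bigmax _ (fun i => \max_j m i j) i).
have y0 i s : s <= 0 -> y i s = 0 by move=> s0; rewrite /y ramp_left// mul0r.
have yN i (t : nat) : (N <= t + mx + 1)%N -> y i (t%:R * h) = 0.
  move=> Nt; rewrite /y ramp_right ?mul0r//.
  have : (T + d) / h < (Num.truncn ((T + d) / h)).+1%:R by exact: truncnS_gt.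
  rewrite ltr_pdivrMr// => /ltW/le_trans; apply; rewrite ler_pM2r// ler_nat.
  move: Nt; rewrite /N addn2 addn1 ltnS -addSn leq_add2r.
  by apply: leq_ltn_trans; exact: leq_addl.
have shiftE (k : nat) (F : R -> R) (t : nat) : (forall s, s <= 0 -> F s = 0) ->
    rshift k (fun t : nat => F (t%:R * h)) t = F (t%:R * h - k%:R * h).
  move=> F0; rewrite /rshift; case: leqP => [kt|tk].
    by rewrite natrB// mulrBl.
  by rewrite F0// subr_le0 ler_pM2r// ler_nat ltnW.
have mtau i j : `|(m i j)%:R * h - tau i j| <= h.
  rewrite -/(mu i j) ler_norml; have := mu_le i j; have := mu_gt i j.
  by move=> ? ?; apply/andP; split; lra.
have supp i j (k : 'I_n) (t : nat) : (N <= t + m i j)%N -> y k (t%:R * h) = 0.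
  move=> Nt; apply: yN; apply: leq_trans Nt _; rewrite -addnA leq_add2l.
  by apply: leq_trans (m_le i j) _; exact: leq_addr.
have supp1 (k : 'I_n) (t : nat) : (N <= t + 1)%N -> y k (t%:R * h) = 0.
  move=> Nt; apply: yN; apply: leq_trans Nt _; rewrite -addnA leq_add2l.
  exact: leq_addl.
have := dissip h m _ mtau N (fun i (t : nat) => y i (t%:R * h)) supp supp1.
rewrite hp hh0 => /(_ isT).
set E := \sum_(t < N) time_energy _ _ _ _.
set S := \sum_(t < N) \sum_i time_res _ _ _ _ _ _ ^+ 2 => H.
have := @hsum_energy R n a tau z A A0 aA aC past growth M (T + 1) M0 zM tau_ge0
  h mu hp mu_ge0 mu_le mu_gt muC d T d0 dT d1 hd erefl N q TE qN (ltW hT).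
have := @hsum_res R n a tau z A A0 aA past growth M (T + 1) M0 zM tau_ge0
  h mu hp mu_ge0 mu_le mu_gt d T d0 dT d1 hd erefl D N tauD D0 (ltW hT).
have yB0 i j s : s <= 0 -> y i s - y j s = 0 by move=> s0; rewrite !y0// subrr.
rewrite [X in d ^+ 2 * (h * X)](_ : _ = S); last first.
  apply: eq_bigr => t _; apply: eq_bigr => i _; rewrite /time_res.
  rewrite (shiftE 1%N (y i)) ?mul1r//; last exact: y0.
  congr ((_ + _) ^+ 2); apply: eq_bigr => j _; congr (_ * _).
  by rewrite (shiftE _ (fun s => y i s - y j s))//; exact: yB0.
rewrite -mulr_sumr [X in h * (2^-1 * X)](_ : _ = E); last first.
  apply: eq_bigr => t _; apply: eq_bigr => i _; apply: eq_bigr => j _.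
  congr (_ * (_ * _)).
  by rewrite (shiftE _ (fun s => y i s - y j s))//; exact: yB0.
move=> le1 le2.
have : \sum_(t < q.+1) ind d T (t%:R * h) * disagreement (fun i => z i (t%:R * h)) <=
    \sum_(t < N) disagreement (fun i => y i (t%:R * h)).
  rewrite -(big_mkord xpredT (fun t : nat => ind d T (t%:R * h) *
     disagreement (fun i => z i (t%:R * h)))).
  rewrite -(big_mkord xpredT (fun t : nat => disagreement (fun i => y i (t%:R * h)))).
  rewrite [leRHS](big_cat_nat (n := q.+1))//=; apply: ler_wpDr.
    by apply: sumr_ge0 => t _; exact: disagreement_ge0.
  apply: ler_sum => t _; have [/andP[dt tT]|/negPf nind] := boolP (d <= t%:R * h <= T); last first.
    by rewrite /ind nind mul0r disagreement_ge0.
  rewrite (ind1 dt tT) mul1r le_eqVlt; apply/orP; left; apply/eqP.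
  apply: eq_bigr => i _; apply: eq_bigr => j _.
  by rewrite /y ramp1// !mul1r.
move=> /(ler_wpM2l (ltW hp))/(ler_wpM2l (ltW e0))/le_trans; apply.
rewrite mulrCA; apply: le_trans (ler_wpM2l (ltW hp) H) _.
have -> : h * (2^-1 * E + d ^+ 2 * S) = h * (2^-1 * E) + d ^+ 2 * (h * S) by ring.
apply: le_trans (lerD le2 le1) _.
by rewrite /energy_cst le_eqVlt; apply/orP; left; apply/eqP; ring.
Qed.

End EnergyEstimate.

(** * Solutions of the delayed equation *)

Section Solution.
Local Open Scope classical_set_scope.
Local Open Scope ring_scope.
Variables (R : realType) (n : nat) (G : delay_graph R n) (x : R -> 'cV[R]_n).
Hypothesis sol : is_solution G x.
Notation mu := (@lebesgue_measure R).
Implicit Types (i j : 'I_n) (s t u c k T : R).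

Let z i t := x t i 0.

Lemma solution_past_coord i t : t < 0 -> z i t = 0.
Proof. by move=> t0; rewrite /z (solution_past sol)// mxE. Qed.

Lemma solution_ac_coord i s t : 0 <= s -> s <= t -> abs_continuous s t (z i).
Proof.
move=> s0 st; apply: (@abs_continuous_sub _ 0 (t + 1)) => //; first by rewrite lerDl.
by apply: (solution_ac sol); rewrite ltr_wpDl// (le_trans s0).
Qed.

Lemma solution_growth i s t c k : 0 <= s -> s <= t ->
  (forall u, s < u -> u < t ->
    `|\sum_j weight G i j * (z j (u - delay G i j) - z i (u - delay G i j)) - c| <= k) ->
  `|z i t - z i s - c * (t - s)| <= k * (t - s).
Proof.
move=> s0 st zk; apply: ae_derive_growth => //; first exact: solution_ac_coord.
have := solution_eq sol; apply: negligibleS => u /= H1 H2; apply: H1 => /andP[su ut].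
exists (\sum_j weight G i j * (z j (u - delay G i j) - z i (u - delay G i j))).
  by apply: H2; rewrite (le_trans s0)// ltW.
exact: zk.
Qed.

Lemma abs_continuous_sum s t (r : seq 'I_n) :
  0 <= s -> s <= t -> abs_continuous s t (fun u => \sum_(i <- r) z i u).
Proof.
move=> s0 st; elim: r => [|i r IH].
  move=> e e0; exists 1 => // m u v _ _ _; rewrite big1// => k _.
  by rewrite !big_nil subrr normr0.
have -> : (fun u => \sum_(j <- i :: r) z j u) = (fun u => z i u + \sum_(j <- r) z j u).
  by apply/funext => u; rewrite big_cons.
by apply: abs_continuousD => //; exact: solution_ac_coord.
Qed.

(** The two ends of each edge receive opposite contributions. *)
Lemma solution_sum t : 0 <= t -> \sum_i z i t = \sum_i z i 0.
Proof.
move=> t0.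
have := @ae_derive_growth R (fun u => \sum_i z i u) 0 t 0 0 t0.
have fac : abs_continuous 0 t (fun u => \sum_i z i u) by exact: abs_continuous_sum.
move=> /(_ fac); rewrite !mul0r !subr0 => H; apply/eqP; rewrite -subr_eq0 -normr_le0.
apply: H; have := solution_eq sol; apply: negligibleS => u /= H1 H2.
apply: H1 => /andP[u0 _]; exists 0; last by rewrite subrr normr0.
have := H2 (ltW u0) => {H2} H2.
have := @is_derive_sum R R R n z u 1 _ H2.
have -> : \sum_i z i = (fun u => \sum_i z i u).
  by apply/funext => w; rewrite fct_sumE.
suff -> : \sum_i \sum_j weight G i j *
   (x (u - delay G i j) j 0 - x (u - delay G i j) i 0) = 0 by [].
set S := \sum_i _; suff : S + S = 0 by lra.
rewrite {2}/S exchange_big -big_split/= big1// => i _; rewrite -big_split/= big1// => j _.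
by rewrite (weight_sym G j i) (delay_sym G j i); ring.
Qed.

Lemma solution_bounded T : 0 <= T -> exists2 M, 0 <= M &
  forall i s, 0 <= s -> s <= T -> `|z i s| <= M.
Proof.
move=> T0.
have bnd i : exists M, forall s, 0 <= s -> s <= T -> `|z i s| <= M.
  have cz : {within `[0, T], continuous (fun s => `|z i s|)}.
    have cx : {within `[0, T], continuous x}.
      apply: continuous_subspaceW (solution_continuous sol) => s /=.
      by rewrite !in_itv/= => /andP[->].
    have cn : continuous (fun v : 'cV[R]_n => `|v i 0|).
      move=> v; apply: (@continuous_comp _ _ _ (fun v : 'cV[R]_n => v i 0) (fun r : R => `|r|)).
        exact: coord_continuous.
      exact: norm_continuous.
    by move=> s; exact: (@cvg_comp _ _ _ x (fun v : 'cV[R]_n => `|v i 0|) _ _ _ (cx s) (cn _)).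
  have [c _ cmax] := EVT_max T0 cz.
  by exists `|z i c| => s s0 sT; apply: cmax; rewrite in_itv/= s0.
have [M MP] := choice bnd.
exists (\sum_i `|M i|) => [|i s s0 sT]; first by apply: sumr_ge0.
apply: le_trans (MP i s s0 sT) _; apply: le_trans (ler_norm _) _.
by rewrite (bigD1 i)//= lerDl sumr_ge0.
Qed.

End Solution.

(** * Recurrence makes Riemann sums diverge *)

Section RiemannSums.
Variable R : realType.
Implicit Types (g : R -> R) (h l r s t c B rho : R).

(** As for the upper bound, with the truncation of [s] to [[l, r - h]]. *)
Lemma sum_ind_ge h l r q : 0 < h -> 0 <= l -> l <= r - h -> r <= q%:R * h ->
  r - l - h <= h * \sum_(t < q.+1) ind l r (t%:R * h).
Proof.
move=> h0 l0 lr rq; pose cl s := Num.min (Num.max s l) (r - h).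
have step (t : nat) : cl (t%:R * h) - cl (t%:R * h - h) <= h * ind l r (t%:R * h).
  set s := t%:R * h.
  have [sl|ls] := ltP s l.
    have clE u : u <= l -> cl u = l by move=> ul; rewrite /cl max_r// min_l.
    by rewrite !clE ?subrr ?mulr_ge0 ?ind_ge0 ?ltW//; lra.
  have [sr|rs] := leP s r.
    rewrite (ind1 ls sr) mulr1.
    have : cl s <= s by rewrite /cl (max_l ls) ge_min lexx.
    have : s - h <= cl (s - h) by rewrite le_min le_max lexx/= lerD2r sr.
    lra.
  have clE u : r - h <= u -> cl u = r - h.
    by move=> ru; rewrite /cl max_l ?min_r// (le_trans lr).
  by rewrite !clE ?subrr ?mulr_ge0 ?ind_ge0 ?ltW//; lra.
rewrite mulr_sumr; apply: le_trans (ler_sum _ (fun (i : 'I_q.+1) _ => step i)).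
rewrite -(big_mkord xpredT (fun t : nat => cl (t%:R * h) - cl (t%:R * h - h))).
pose F (t : nat) := cl (t%:R * h - h).
rewrite (eq_big_nat _ _ (F2 := fun t : nat => F t.+1 - F t)); last first.
  by move=> t _; rewrite /F -natr1; congr (cl _ - _); ring.
rewrite telescope_sumr// /F.
have -> : cl (q.+1%:R * h - h) = r - h.
  rewrite /cl min_r// le_max -natr1; apply/orP; left.
  by rewrite mulrDl mul1r addrK; lra.
have -> : cl (0%:R * h - h) = l by rewrite /cl mul0r max_r ?min_l//; lra.
lra.
Qed.

(** Each return contributes at least [c * (rho / 2)] as soon as the step is at most
    half the time spent above [c]. *)
Lemma riemann_sums_unbounded g c rho : 0 < c -> 0 < rho -> (forall s, 0 <= g s) ->
  (forall T, exists2 t, T <= t & forall s, t <= s -> s <= t + rho -> c <= g s) ->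
  forall p : nat, exists2 T, 1 <= T & forall h q, 0 < h -> h <= rho / 2 ->
    T <= q%:R * h ->
    p%:R * (c * (rho / 2)) <= h * \sum_(t < q.+1) ind 1 T (t%:R * h) * g (t%:R * h).
Proof.
move=> c0 rho0 g0 ret; elim=> [|p [T T1 IH]].
  exists 1 => // h q h0 _ _; rewrite mul0r; apply: mulr_ge0; first exact: ltW.
  by apply: sumr_ge0 => t _; rewrite mulr_ge0 ?ind_ge0.
(* The next return happens after [T], hence in a disjoint block. *)
have [t tT tg] := ret (T + 1).
exists (t + rho) => [|h q h0 hr tq]; first lra.
have Tq : T <= q%:R * h by lra.
have IHq := IH h q h0 hr Tq.
have := @sum_ind_ge h t (t + rho) q h0.
have -> : 0 <= t by lra.
have -> : t <= t + rho - h by lra.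
rewrite tq => /(_ isT isT isT) cnt.
rewrite -natr1 mulrDl mul1r.
apply: (@le_trans _ _ (h * \sum_(u < q.+1) ind 1 T (u%:R * h) * g (u%:R * h) +
   c * (h * \sum_(u < q.+1) ind t (t + rho) (u%:R * h)))).
  by apply: lerD => //; rewrite ler_pM2l//; lra.
rewrite mulrCA -mulrDr ler_pM2l// mulr_sumr -big_split/=; apply: ler_sum => u _.
set s := u%:R * h; have := g0 s; have i0 := ind_ge0 t (t + rho) s.
have [/andP[ts str]|/negPf nts] := boolP (t <= s <= t + rho).
  move=> gs; rewrite (ind1 ts str) (@ind1 _ 1 (t + rho))//; last lra.
  rewrite [ind 1 T s](_ : _ = 0); first by rewrite mul0r add0r mulr1 mul1r tg.
  by rewrite /ind [s <= T]leNgt (_ : T < s) ?andbF//; lra.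
move=> gs; rewrite /ind nts mulr0 addr0; apply: ler_wpM2r => //.
rewrite ler_nat; case: (boolP (1 <= s <= T)) => // /andP[s1 sT].
by rewrite s1 (_ : s <= t + rho)//; lra.
Qed.

End RiemannSums.

(** * Average consensus *)

Section Consensus.
Variables (R : realType) (n : nat) (G : delay_graph R n) (x : R -> 'cV[R]_n).
Hypothesis sol : is_solution G x.
Hypothesis hL : forall s : R[i], 0 <= complex.Re s ->
  psd (freq_signed_laplacian G s) /\ simple_eigenvalue (freq_signed_laplacian G s) 0.
Implicit Types (i j : 'I_n) (s t u c k h d T M w : R).

Let z i t := x t i 0.
Let a i j := weight G i j.
Let tau i j := delay G i j.
Let A := \sum_i \sum_j `|a i j|.
Let D := \sum_i \sum_j tau i j.

Let A0 : 0 <= A. Proof. by apply: sumr_ge0 => i _; apply: sumr_ge0. Qed.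

Let tau_ge0 i j : 0 <= tau i j. Proof. exact: delay_ge0. Qed.

Let D0 : 0 <= D. Proof. by apply: sumr_ge0 => i _; apply: sumr_ge0. Qed.

Lemma le_double_sum (F : 'I_n -> 'I_n -> R) i j :
  (forall i j, 0 <= F i j) -> F i j <= \sum_i \sum_j F i j.
Proof.
move=> F0; rewrite (bigD1 i)//= (bigD1 j)//= -addrA lerDl addr_ge0//.
  exact: sumr_ge0.
by apply: sumr_ge0 => k _; exact: sumr_ge0.
Qed.

Let aA i j : `|a i j| <= A.
Proof. exact: (@le_double_sum (fun i j => `|a i j|)). Qed.

Let tauD i j : tau i j <= D. Proof. exact: le_double_sum. Qed.

Let aC i j : a i j = a j i. Proof. exact: weight_sym. Qed.

Let tauC i j : tau i j = tau j i. Proof. exact: delay_sym. Qed.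

(** On the imaginary axis the exponential factors of the weights are [1]. *)
Lemma imaginary_axis_weights w (v : 'I_n -> R) :
  let W := \matrix_(i, j) (weight G i j * expR (- (delay G i j * complex.Re (0 +i* w)%C))
                  * cos (delay G i j * complex.Im (0 +i* w)%C)) in
  \sum_i \sum_j a i j * cos (tau i j * w) * (v i - v j) ^+ 2 =
  \sum_i \sum_j W i j * ((\col_i v i) i 0 - (\col_i v i) j 0) ^+ 2.
Proof.
move=> W; apply: eq_bigr => i _; apply: eq_bigr => j _.
by rewrite !mxE /= mulr0 oppr0 expR0 mulr1.
Qed.

Lemma imaginary_axis_uniform W : 0 <= W -> exists2 e : R, 0 < e &
  forall w (v : 'I_n -> R), `|w| <= W -> e * disagreement v <=
    \sum_i \sum_j a i j * cos (tau i j * w) * (v i - v j) ^+ 2.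
Proof.
have symW w i j : let W := \matrix_(i, j) (weight G i j *
      expR (- (delay G i j * complex.Re (0 +i* w)%C)) *
      cos (delay G i j * complex.Im (0 +i* w)%C)) in W i j = W j i.
  by rewrite /= !mxE (weight_sym G i j) (delay_sym G i j).
apply: uniform_form_bound => [w v|w v].
  have [Lpsd _] := hL (lexx 0 : 0 <= complex.Re (0 +i* w)%C).
  rewrite imaginary_axis_weights; apply: psd_laplacian_ge0 Lpsd; exact: symW.
have [Lpsd L0] := hL (lexx 0 : 0 <= complex.Re (0 +i* w)%C).
rewrite imaginary_axis_weights => /(simple_zero_consensus (symW w) Lpsd L0) vE i j.
by have := vE i j; rewrite !mxE.
Qed.

Let qs t := \sum_i z i t ^+ 2.
Let C := energy_cst n A D.

Let estimate d (d0 : 0 < d) (d1 : d <= 1) := energy_estimate A0 aA aC tau_ge0 tauC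
  tauD D0 (solution_past_coord sol) (solution_growth sol) imaginary_axis_uniform d0 d1.

(** Steps that divide [T] exactly can be as small as desired. *)
Let mesh T h1 : 0 < T -> 0 < h1 -> exists h, exists q : nat,
  [/\ 0 < h, h < h1 & T = q%:R * h].
Proof.
move=> T0 h1_gt0; pose q := (Num.truncn (T / h1)).+1.
have q0 : (0 : R) < q%:R by rewrite ltr0n.
exists (T / q%:R), q; split; first by rewrite divr_gt0.
  by rewrite ltr_pdivrMr// mulrC -ltr_pdivrMr// truncnS_gt.
by rewrite mulrC divfK// gt_eqF.
Qed.

(** The delayed coupling is passive: the energy estimate without its left-hand
    side, in the limit of short ramps. *)
Lemma norm_le_initial T : 1 <= T -> qs T <= qs 0.
Proof.
move=> T1; apply/ler_addgt0Pr => eps eps0; have T0 : 0 <= T + 1 by lra.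
have [M M0 zM] := solution_bounded sol T0.
pose K := `|C * M ^+ 2| + 1; have K0 : 0 < K by rewrite ltr_wpDl.
pose d := Num.min 1 (eps / (2 * K)).
have d0 : 0 < d by rewrite lt_min ltr01 divr_gt0// mulr_gt0.
have d1 : d <= 1 by rewrite ge_min lexx.
have [e e0 /(_ T M (le_trans d1 T1) M0 zM)[h1 h1_gt0 est]] := estimate d0 d1.
have [h [q [h0 hh1 TE]]] := mesh (lt_le_trans ltr01 T1) h1_gt0.
have := est h q h0 hh1 TE; rewrite -/(qs 0) -/(qs T) -/C => le_est.
have pos : 0 <= e * (h * \sum_(t < q.+1) ind d T (t%:R * h) *
               disagreement (fun i => z i (t%:R * h))).
  apply: mulr_ge0; first exact: ltW.
  apply: mulr_ge0; first exact: ltW.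
  by apply: sumr_ge0 => t _; rewrite mulr_ge0 ?ind_ge0 ?disagreement_ge0.
have : C * M ^+ 2 * d <= eps / 2.
  apply: le_trans (_ : K * d <= _).
    by rewrite ler_pM2r// (le_trans (ler_norm _))// lerDl.
  rewrite mulrC -ler_pdivlMr//.
  have -> : eps / 2 / K = eps / (2 * K) by field; exact: lt0r_neq0.
  by rewrite ge_min lexx orbT.
lra.
Qed.

Lemma solution_bounded_global : exists2 M, 0 <= M & forall i s, 0 <= s -> `|z i s| <= M.
Proof.
have [M M0 zM] := solution_bounded sol (@ler01 R).
have q0 : 0 <= qs 0 by apply: sumr_ge0 => i _; exact: sqr_ge0.
exists (M + 1 + qs 0) => [|i s s0]; first by rewrite !addr_ge0.
have [s1|/ltW s1] := leP s 1; first by have := zM i s s0 s1; rewrite -/(z i s); lra.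
have zq : z i s ^+ 2 <= qs 0.
  apply: le_trans (norm_le_initial s1); rewrite /qs (bigD1 i)//= lerDl.
  by apply: sumr_ge0 => j _; exact: sqr_ge0.
have := sqr_ge0 (`|z i s| - 1); rewrite sqrrB1 real_normK ?num_real//.
by have := normr_ge0 (z i s); lra.
Qed.

(** The Riemann sums of the disagreement are bounded uniformly in the horizon,
    and the disagreement is Lipschitz; if it kept returning above [eta], it would
    stay above [eta / 2] for a fixed time after each return. *)
Lemma disagreement_to0 eta : 0 < eta ->
  exists T, forall t, T <= t -> disagreement (fun i => z i t) <= eta.
Proof.
move=> eta0; apply: contrapT => /forallNP noT.
have [M M0 zM] := solution_bounded_global.
pose L := n%:R * (n%:R * (8 * M * (2 * n%:R * A * M))).
have L0 : 0 <= L by rewrite !mulr_ge0.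
pose g t := disagreement (fun i => z i t).
have g0 t : 0 <= g t by exact: disagreement_ge0.
have gL s t : 0 <= s -> s <= t -> g s - g t <= L * (t - s).
  move=> s0 st; rewrite /g /disagreement -sumrB.
  rewrite /L -!mulrA; apply: sum_le_const => i.
  rewrite -sumrB; apply: sum_le_const => j.
  have t0 : 0 <= t by exact: le_trans st.
  have zMt (k : 'I_n) u : 0 <= u -> u <= t -> `|z k u| <= M by move=> u0 _; exact: zM.
  have lipst := zd_lipschitz aA (solution_past_coord sol)
    (solution_growth sol) M0 zMt tau_ge0 i j s0 st (lexx t).
  rewrite subr_sqr; apply: le_trans (ler_norm _) _; rewrite normrM mulrC.
  have -> : 8 * (M * (2 * (n%:R * (A * (M * (t - s)))))) =
    (4 * M) * (2 * (2 * n%:R * A * M) * (t - s)) by ring.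
  apply: ler_pM => //; last by rewrite distrC.
  have := zM i s s0; have := zM j s s0; have := zM i t t0; have := zM j t t0.
  rewrite !ler_norml => /andP[? ?] /andP[? ?] /andP[? ?] /andP[? ?].
  by apply/andP; split; lra.
pose rho := eta / (2 * (L + 1)).
have L1 : 0 < L + 1 by lra.
have rho0 : 0 < rho by rewrite divr_gt0// mulr_gt0.
have ret T : exists2 t, T <= t & forall s, t <= s -> s <= t + rho -> eta / 2 <= g s.
  have /existsNP[t /not_implyP[Tt /negP]] := noT (Num.max 0 T).
  rewrite -ltNge -/(g t) => gt; move: Tt; rewrite ge_max => /andP[t0 Tt].
  exists t => // s ts str; have := gL t s t0 ts.
  have : L * (s - t) <= (L + 1) * rho.
    by apply: ler_pM => //; lra.
  have -> : (L + 1) * rho = eta / 2 by rewrite /rho; field; exact: lt0r_neq0.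
  lra.
have eta2 : 0 < eta / 2 by rewrite divr_gt0.
have unb := riemann_sums_unbounded eta2 rho0 g0 ret.
have [e e0 est] := estimate ltr01 (lexx 1).
pose B := (2^-1 * qs 0 + C * M ^+ 2) / e.
pose c := eta / 2 * (rho / 2).
have c0 : 0 < c by rewrite mulr_gt0// divr_gt0.
pose p := (Num.truncn (B / c)).+1.
have Bp : B < p%:R * c by rewrite -ltr_pdivrMr// truncnS_gt.
have [T T1 unbT] := unb p.
have zMT i s : 0 <= s -> s <= T + 1 -> `|z i s| <= M by move=> s0 _; exact: zM.
have [h1 h1_gt0 estT] := est T M T1 M0 zMT.
have h2_gt0 : 0 < Num.min h1 (rho / 2) by rewrite lt_min h1_gt0 divr_gt0.
have [h [q [h0 + TE]]] := mesh (lt_le_trans ltr01 T1) h2_gt0.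
rewrite lt_min => /andP[hh1 /ltW hrho].
have := estT h q h0 hh1 TE; rewrite -/(qs 0) -/(qs T) -/C mulr1.
have TqE : T <= q%:R * h by rewrite -TE.
have := unbT h q h0 hrho TqE; rewrite -/c => unb_le est_le.
have qT : 0 <= qs T by apply: sumr_ge0 => i _; exact: sqr_ge0.
have : e * (p%:R * c) <= e * B.
  apply: (le_trans (ler_wpM2l (ltW e0) unb_le)); apply: le_trans est_le _.
  by rewrite /B [leRHS]mulrC divfK ?gt_eqF//; lra.
by rewrite ler_pM2l// leNgt Bp.
Qed.

Lemma solution_consensus :
  (x t @[t --> +oo] --> (const_mx (average (x 0)) : 'cV[R]_n))%classic.
Proof.
apply/cvgrPdist_le => eps eps0.
have [T Tle] := disagreement_to0 (exprn_gt0 2 eps0).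
near=> t.
have t0 : 0 <= t by near: t; apply: nbhs_pinfty_ge; exact: num_real.
have Tt : T <= t by near: t; apply: nbhs_pinfty_ge; exact: num_real.
rewrite [leLHS]/Num.norm /= mx_normrE; apply/bigmax_leP; split=> [|[i k] _ /=]; first exact: ltW.
rewrite !mxE (ord1 k) /average -/(z i t).
have -> : \sum_j x 0 j 0 = \sum_j z j t by rewrite (solution_sum sol t0).
have n0 : (0 < n)%N by apply: leq_ltn_trans (ltn_ord i).
have nR : (0 : R) < n%:R by rewrite ltr0n.
have -> : n%:R^-1 * \sum_j z j t - z i t = n%:R^-1 * \sum_j (z j t - z i t).
  rewrite sumrB sumr_const card_ord mulrBr -[X in _ - _ * X]mulr_natl mulKf//.
  exact: lt0r_neq0.
rewrite normrM (ger0_norm (x := n%:R^-1)) ?invr_ge0// ler_pdivrMl//.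
apply: le_trans (ler_norm_sum _ _ _) _; apply: sum_le_const => j.
have eps_ge0 := ltW eps0.
rewrite -ler_sqr ?nnegrE// real_normK ?num_real//.
apply: le_trans (Tle t Tt).
apply: (@le_double_sum (fun i j => (z i t - z j t) ^+ 2)) => i' j'.
exact: sqr_ge0.
Unshelve. all: by end_near.
Qed.

End Consensus.

Theorem theorem1 (R : realType) (n : nat) (G : delay_graph R n)
  (hL0 : psd (signed_laplacian0 G) /\
         simple_eigenvalue (signed_laplacian0 G) 0)
  (hL : forall s : R[i], 0 <= complex.Re s ->
     psd (freq_signed_laplacian G s) /\
     simple_eigenvalue (freq_signed_laplacian G s) 0) :
  reaches_average_consensus G.
Proof. by move=> x0 x sol <-; exact: (solution_consensus sol hL). Qed.
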